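(* For any $0<r<\log 1.01$, $$\mu\Big(\bigcup_{0\le s<1}a_{-s}K_r\Big)\asymp r\log\Big(\frac1r\Big),$$ i.e. the left side is bounded above and below by absolute positive constant multiples of $r\log(1/r)$.
   Context: $X=\mathrm{SL}_2(\mathbb{R})/\mathrm{SL}_2(\mathbb{Z})$ is the space of unimodular lattices in $\mathbb{R}^2$, and $\mu$ is the $\mathrm{SL}_2(\mathbb{R})$-invariant probability measure on $X$. $\|\cdot\|$ denotes the supremum norm on $\mathbb{R}^2$. For $\Lambda\in X$ let $\Delta(\Lambda)=\sup_{v\in\Lambda\smallsetminus\{0\}}\log(1/\|v\|)$, and for $r\ge0$ let $K_r=\Delta^{-1}([0,r])$. For $s\in\mathbb{R}$, $a_s=\mathrm{diag}(e^s,e^{-s})$, acting on $X$ by left multiplication. *)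

(* Defs.v *)
From HB Require Import structures.
From mathcomp Require Import all_boot all_order all_algebra.
From mathcomp Require Import all_classical all_reals all_analysis.
Set Implicit Arguments. Unset Strict Implicit. Unset Printing Implicit Defensive.
Import Order.TTheory GRing.Theory Num.Theory.
Import numFieldNormedType.Exports.
Local Open Scope classical_set_scope.
Local Open Scope ring_scope.

Section Defs.
Variable R : realType.

(* A 2x2 real matrix [[a, b], [c, d]] is encoded as ((a, b), (c, d)). *)
Definition mat := ((R * R) * (R * R))%type.

Definition det (g : mat) : R := g.1.1 * g.2.2 - g.1.2 * g.2.1.

Definition mulmv (g : mat) (v : R * R) : R * R :=
  (g.1.1 * v.1 + g.1.2 * v.2, g.2.1 * v.1 + g.2.2 * v.2).

Definition latt (g : mat) : set (R * R) :=
  [set v | exists m n : int, v = mulmv g (m%:~R, n%:~R)].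

Definition unimod : set (set (R * R)) :=
  [set L | exists g : mat, det g = 1 /\ L = latt g].

Definition act (g : mat) (L : set (R * R)) : set (R * R) := mulmv g @` L.

Definition a_ (s : R) : mat := ((expR s, 0), (0, expR (- s))).

Definition supnorm (v : R * R) : R := Num.max `|v.1| `|v.2|.

Definition Delta (L : set (R * R)) : \bar R :=
  ereal_sup [set (ln ((supnorm v)^-1))%:E | v in L `\ (0, 0)].

Definition K_ (r : R) : set (set (R * R)) :=
  [set L | unimod L /\ (0%E <= Delta L)%E /\ (Delta L <= r%:E)%E].

Definition Ucyl (r : R) : set (set (R * R)) :=
  [set L | exists s : R, 0 <= s /\ s < 1 /\
           exists2 L', K_ r L' & L = act (a_ (- s)) L'].

(* Haar measure on SL_2(R) via the cone construction:
   m(A) = Leb_4 { t g | g in A, 0 < t <= 1 },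
   restricted to the fundamental domain of Gauss-reduced bases
   (|v1| <= |v2|, 2|<v1,v2>| <= |v1|^2, columns v1 v2), then normalised. *)
Definition leb4 : set mat -> \bar R :=
  ((@lebesgue_measure R \x @lebesgue_measure R) \x
   (@lebesgue_measure R \x @lebesgue_measure R))%E.

Definition reduced (g : mat) : Prop :=
  let n1 := g.1.1 ^+ 2 + g.2.1 ^+ 2 in
  let n2 := g.1.2 ^+ 2 + g.2.2 ^+ 2 in
  let ip := g.1.1 * g.1.2 + g.2.1 * g.2.2 in
  n1 <= n2 /\ 2 * `|ip| <= n1.

Definition scalemat (t : R) (g : mat) : mat :=
  ((t * g.1.1, t * g.1.2), (t * g.2.1, t * g.2.2)).

Definition FDcone (E : set (set (R * R))) : set mat :=
  [set g | 0 < det g /\ det g <= 1 /\ reduced g /\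
           E (latt (scalemat (Num.sqrt (det g))^-1 g))].

Definition mu (E : set (set (R * R))) : \bar R :=
  (leb4 (FDcone E) * ((fine (leb4 (FDcone unimod)))^-1)%:E)%E.

End Defs.

(* Main.v *)
Require Import Defs.
From HB Require Import structures.
From mathcomp Require Import all_boot all_order all_algebra.
From mathcomp Require Import all_classical all_reals all_analysis.
From mathcomp Require Import measurable_realfun ring lra zify.
Set Implicit Arguments. Unset Strict Implicit. Unset Printing Implicit Defensive.
Import Order.TTheory GRing.Theory Num.Theory.
Import numFieldNormedType.Exports.
Local Open Scope classical_set_scope.
Local Open Scope ring_scope.

(** A unimodular lattice all of whose nonzero vectors have sup norm at least
    [1 - 2r] is nearly critical for the unit square. Minkowski's theorem in the
    boxes [b^-1 x b] and [b x b^-1], [b = 1 - 2r], yields lattice vectors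
    [(p, y)] and [(x, q)] whose determinant is [1] or [2]; either way the lattice
    contains two nonzero vectors [w], [w'] of bounded length with
    [|w.1 * w'.2| = O(r)]. This product is invariant under the flow [a_s], so it
    bounds the whole cylinder: for a reduced basis [[a, b], [c, d]] there are
    boundedly many integer vectors [(m, n)], [(m', n')] such that
    [|(m a + n b) (m' c + n' d)| = O(r)]. Cutting this hyperbolic region into
    about [ln (1 / r)] products of strips of widths [e^-k] and [r e^k] gives the
    upper bound. Conversely, bases with [b >= 0 >= c] and [b (- c) <= r / 5] in a
    fixed box lie in the cylinder, because then no cancellation between the two
    basis vectors is possible; about [ln (1 / r)] disjoint boxes of volume
    proportional to [r] fit there. The normalising covolume is finite since the
    part of the reduction domain with first basis vector of length about [2^-k]
    has volume [O(2^-k)]. *)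

(** * Product measures on arbitrary sets *)

(* The integral of any nonnegative function, measurable or not, is a supremum
   over the simple functions below it. *)
Lemma le_integral_nonneg (d : measure_display) (T : measurableType d) (R : realType)
    (m : {measure set T -> \bar R}) (f g : T -> \bar R) :
  (forall x, 0 <= f x)%E -> (forall x, f x <= g x)%E ->
  (\int[m]_x f x <= \int[m]_x g x)%E.
Proof.
move=> f0 fg.
have g0 x : (0 <= g x)%E by exact: le_trans (f0 x) (fg x).
rewrite !ge0_integralTE//; apply: ereal_sup_le => _ [h /= hf <-].
by exists h => // x; exact: le_trans (hf x) (fg x).
Qed.

(** The cones [FDcone E] are compared as arbitrary sets. Lebesgue measure is monotone on these as an
    outer measure, and the property passes to products through the integral of section measures. *)
Lemma le_product_measure (d1 d2 : measure_display) (T1 : measurableType d1)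
    (T2 : measurableType d2) (R : realType) (m1 : {measure set T1 -> \bar R})
    (m2 : {measure set T2 -> \bar R}) :
  {homo m2 : A B / A `<=` B >-> (A <= B)%E} ->
  {homo (m1 \x m2)%E : A B / A `<=` B >-> (A <= B)%E}.
Proof.
move=> hm A B AB; apply: le_integral_nonneg => x /=; first exact: measure_ge0.
by apply: hm; exact: le_xsection.
Qed.

(** The section measures are dominated by [k] times the indicator of [P]. The bounds for strips and
    cusp pieces rest on this. *)
Lemma product_measure_le_sections (d1 d2 : measure_display) (T1 : measurableType d1)
    (T2 : measurableType d2) (R : realType) (m1 : {measure set T1 -> \bar R})
    (m2 : {measure set T2 -> \bar R}) (A : set (T1 * T2)) (P : set T1) (k : R) :
  0 <= k -> measurable P -> (forall z, A z -> P z.1) ->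
  (forall x, P x -> (m2 [set y | A (x, y)] <= k%:E)%E) ->
  ((m1 \x m2)%E A <= k%:E * m1 P)%E.
Proof.
move=> k0 mP AP Ak.
have -> : (k%:E * m1 P = \int[m1]_x (k%:E * (\1_P x)%:E))%E.
  rewrite ge0_integralZl//; first by rewrite integral_indic// setIT.
  by apply/measurable_EFinP; exact: measurable_indic.
apply: le_integral_nonneg => x /=; first exact: measure_ge0.
have xE : xsection A x = [set y | A (x, y)].
  by apply/seteqP; split=> y /=; rewrite /xsection/= inE.
have [Px|Px] := pselect (P x).
  by rewrite indicE mem_set// mule1 xE; exact: Ak.
suff -> : xsection A x = set0 by rewrite measure0 mule_ge0// lee_fin.
by rewrite xE -subset0 => y /= /AP.
Qed.

(** * Lebesgue measure in dimensions one, two and four *)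

Section leb.
Variable R : realType.
Local Notation leb := (@lebesgue_measure R).
Local Notation leb2 := (leb \x leb)%E.

Lemma le_lebesgue : {homo leb : A B / A `<=` B >-> (A <= B)%E}.
Proof. by move=> A B AB; apply: le_outer_measure. Qed.

Lemma le_lebesgue2 : {homo leb2 : A B / A `<=` B >-> (A <= B)%E}.
Proof. by move=> A B AB; exact: (le_product_measure leb le_lebesgue). Qed.

Lemma le_leb4 : {homo @leb4 R : A B / A `<=` B >-> (A <= B)%E}.
Proof. by move=> A B AB; exact: (le_product_measure leb2 le_lebesgue2). Qed.

Lemma leb_itv (a b : R) : a <= b -> leb `[a, b] = (b - a)%:E.
Proof.
move=> ab; rewrite lebesgue_measure_itv/= lte_fin; case: ltP => // ba.
by rewrite (le_anti (introT andP (conj ab ba))) subrr.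
Qed.

Lemma lebesgue_abs_affine_le (u v w : R) : u != 0 -> 0 <= w ->
  (leb [set x | `|u * x + v| <= w]%R <= (2 * w / `|u|)%:E)%E.
Proof.
move=> u0 w0.
have U0 : 0 < `|u| by rewrite normr_gt0.
apply: (@le_trans _ _ (leb `[- v / u - w / `|u|, - v / u + w / `|u|])).
  apply: le_lebesgue => x /=; rewrite in_itv/= => h.
  have : `|x + v / u| <= w / `|u|.
    rewrite ler_pdivlMr// -normrM (_ : (x + v / u) * u = u * x + v)//.
    by field.
  rewrite ler_norml mulNr; lra.
have wu : 0 <= w / `|u| by rewrite divr_ge0// ltW.
rewrite leb_itv; last lra.
by rewrite lee_fin -mulrA; lra.
Qed.

(* An alias is needed because the canonical sigma-finite structure that
   unification finds on [m1 \x m2] is the one for subprobabilities. *)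
Definition lebesgue2 : set (measurableTypeR R * measurableTypeR R) -> \bar R := leb2.

HB.instance Definition _ := Measure.on lebesgue2.

Lemma sigma_finite_lebesgue2 : sigma_finite setT lebesgue2.
Proof.
have /sigma_finiteP[F [TF ndF Foo]] := sigma_finiteT leb.
exists (fun n => F n `*` F n).
  rewrite -setXTT {1}TF {1}TF; apply/seteqP; split=> -[x y] /=.
    move=> [[n _ Fx] [k _ Fy]]; exists (maxn n k) => //; split.
      by move: x Fx; exact/subsetPset/ndF/leq_maxl.
    by move: y Fy; exact/subsetPset/ndF/leq_maxr.
  by move=> [n _ [/= ? ?]]; split; exists n.
move=> k; have [mF Fk] := Foo k; split; first exact: measurableX.
by rewrite /lebesgue2 product_measure1E// lte_mul_pinfty// ge0_fin_numE.
Qed.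

HB.instance Definition _ :=
  Measure_isSigmaFinite.Build _ _ _ lebesgue2 sigma_finite_lebesgue2.

Definition lebesgue4 : {measure set _ -> \bar R} :=
  [the {measure set _ -> \bar R} of (lebesgue2 \x lebesgue2)%E].

Lemma leb4E A : leb4 A = lebesgue4 A. Proof. by []. Qed.

Lemma lebesgue4X A B : measurable A -> measurable B ->
  lebesgue4 (A `*` B) = (leb2 A * leb2 B)%E.
Proof. exact: product_measure1E. Qed.
End leb.

(** * Short vectors of planar lattices *)

Section lattices.
Variable R : realType.
Implicit Types (h : mat R) (m n : int).

Definition latv h m n : R * R := mulmv h (m%:~R, n%:~R).

Lemma supnorm_le (v : R * R) (k : R) :
  (supnorm v <= k) = (`|v.1| <= k) && (`|v.2| <= k).
Proof. by rewrite /supnorm ge_max. Qed.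

Lemma supnorm_lt (v : R * R) (k : R) :
  (supnorm v < k) = (`|v.1| < k) && (`|v.2| < k).
Proof. by rewrite /supnorm gt_max. Qed.

Lemma det_latv h m n m' n' :
  (latv h m n).1 * (latv h m' n').2 - (latv h m' n').1 * (latv h m n).2
  = det h * (m * n' - m' * n)%:~R.
Proof. by rewrite /latv/mulmv/det/= rmorphB/= !rmorphM/=; ring. Qed.

(** Cramer's rule recovers the integer coefficients from the vector, the inverse of [h] having the
    same entries up to sign and position. *)
Lemma latv_coord_bound h m n (k : R) : det h = 1 -> supnorm (latv h m n) <= k ->
  (`|m|%:~R <= k * (`|h.1.1| + `|h.1.2| + `|h.2.1| + `|h.2.2|)) /\
  (`|n|%:~R <= k * (`|h.1.1| + `|h.1.2| + `|h.2.1| + `|h.2.2|)).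
Proof.
case: h => [[a b] [c d]]; rewrite supnorm_le /latv /det /mulmv /= => dt.
set X := _ + _; set Y := c * _ + _ => /andP[Xk Yk].
have mE : m%:~R = X * d - Y * b :> R.
  by transitivity ((a * d - b * c) * m%:~R); [rewrite dt mul1r | rewrite /X /Y; ring].
have nE : n%:~R = Y * a - X * c :> R.
  by transitivity ((a * d - b * c) * n%:~R); [rewrite dt mul1r | rewrite /X /Y; ring].
have H u v : `|u * v| = `|u| * `|v| :> R by rewrite normrM.
have [a0 b0 c0 d0] : [/\ 0 <= `|a|, 0 <= `|b|, 0 <= `|c| & 0 <= `|d|] by [].
have k0 : 0 <= k by apply: le_trans Xk.
split; rewrite intr_norm.
  rewrite mE (le_trans (ler_normB _ _))// !H.
  have := ler_wpM2r d0 Xk; have := ler_wpM2r b0 Yk.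
  have := mulr_ge0 k0 a0; have := mulr_ge0 k0 c0; lra.
rewrite nE (le_trans (ler_normB _ _))// !H.
have := ler_wpM2r c0 Xk; have := ler_wpM2r a0 Yk.
have := mulr_ge0 k0 b0; have := mulr_ge0 k0 d0; lra.
Qed.

(** By the coefficient bound only finitely many pairs can beat the image of [(1, 0)], so a minimum
    over a finite box is global. *)
Lemma exists_shortest h : det h = 1 ->
  exists m0 n0, (m0, n0) != (0, 0) /\
    forall m n, (m, n) != (0, 0) ->
      supnorm (latv h m0 n0) <= supnorm (latv h m n).
Proof.
move=> dt.
pose B := supnorm (latv h 1 0) * (`|h.1.1| + `|h.1.2| + `|h.2.1| + `|h.2.2|).
(* The successor makes it evident that [(1, 0)] lies in the search box. *)
pose N := (Num.bound `|B|).+1.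
have BN k : k%:~R <= B -> k <= N%:Z.
  move=> kB; rewrite -(ler_int R); apply: (le_trans kB).
  apply: (le_trans (ler_norm B)); apply: ltW; apply: (lt_le_trans (archi_boundP _)) => //.
  by rewrite -pmulrn ler_nat leqnSn.
pose pos (i : 'I_(N + N).+1) : int := i%:Z - N%:Z.
have posP k : `|k| <= N%:Z -> exists i, pos i = k.
  move=> kN; have lt : (`|(k + N%:Z)%R| < (N + N).+1)%N by lia.
  by exists (Ordinal lt); rewrite /pos/=; lia.
pose P (i : 'I_(N + N).+1 * 'I_(N + N).+1) := (pos i.1, pos i.2) != (0, 0).
have [i1 i1E] : exists i, pos i = 1 by apply: posP; rewrite /N; lia.
have [i0 i0E] : exists i, pos i = 0 by apply: posP; rewrite /N; lia.
have Pi : P (i1, i0) by rewrite /P/= i1E i0E.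
pose F (i : 'I_(N + N).+1 * 'I_(N + N).+1) := supnorm (latv h (pos i.1) (pos i.2)).
case: (@arg_minP _ _ _ (i1, i0) P F Pi) => i Pi' imin.
exists (pos i.1), (pos i.2); split => // m n mn0.
have [le|/ltW le] := leP (supnorm (latv h m n)) (supnorm (latv h 1 0)).
  have [/BN/posP[j jE] /BN/posP[l lE]] := latv_coord_bound dt le.
  by have := imin (j, l); rewrite /P /F /= jE lE; apply.
by apply: le_trans le; have := imin _ Pi; rewrite /F /= i1E i0E.
Qed.
End lattices.

(** * Minkowski's theorem for boxes of area 4 *)

Section minkowski.
Variable R : realType.
Implicit Types (h : mat R) (m n : int).

Lemma latv_comb h m n m' n' (j : int) :
  latv h (m + j * m') (n + j * n') =
  ((latv h m n).1 + j%:~R * (latv h m' n').1,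
   (latv h m n).2 + j%:~R * (latv h m' n').2).
Proof.
by rewrite /latv/mulmv/= !rmorphD/= !rmorphM/=; congr (_, _); ring.
Qed.

(** Here [(p, y)] plays a shortest vector of norm above 1 and [(x, q)] completes it to a basis. The
    shifted vector found here is strictly shorter, which contradicts minimality. *)
Lemma companion_vector (p y x q : R) : 1 < `|p| -> `|y| <= `|p| ->
  p * q - y * x = 1 ->
  exists j : int, `|x + j%:~R * p| < `|p| /\ `|q + j%:~R * y| < `|p|.
Proof.
wlog p0 : p y x q / 0 < p => [wl p1 yp pq|].
  have [p0|p0|p0] := ltgtP p 0; last by move: p1; rewrite p0 normr0 ltr10.
    have [||||j [j1 j2]] := wl (- p) (- y) (- x) (- q); rewrite ?oppr_gt0 ?normrN//.
      by rewrite !mulrNN.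
    by exists j; move: j1 j2; rewrite !mulrN -!opprD !normrN.
  exact: wl.
rewrite (gtr0_norm p0) => p1 yp pq.
(* Choosing [x'] with [y * x' <= 0] makes [p * q' = 1 + y * x'] small. *)
have key x' q' : p * q' - y * x' = 1 -> `|x'| < p -> y * x' <= 0 -> `|q'| < p.
  move=> e x'p yx.
  have lt : `|y| * `|x'| < p * p.
    by apply: le_lt_trans (ler_wpM2r (normr_ge0 _) yp) _; rewrite ltr_pM2l.
  have : - (p * p) < y * x'.
    by rewrite ltrNl (le_lt_trans _ lt)// -normrM -normrN ler_norm.
  move=> lo; rewrite -(ltr_pM2l p0) -[X in X * `|_|](gtr0_norm p0) -normrM.
  have -> : p * q' = 1 + y * x' by lra.
  rewrite ltr_norml; apply/andP; split; first by lra.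
  by apply: le_lt_trans (_ : 1 < _); [lra | nra].
(* The residues of [x] modulo [p] in [[0, p)] and in [[-p, 0)] lie on either side of 0, so one of
   them meets the sign condition of [key]. *)
pose f := Num.floor (x / p).
have f1 : f%:~R * p <= x by rewrite -ler_pdivlMr// floor_le.
have f2 : x < (f%:~R + 1) * p.
  by rewrite -ltr_pdivrMr//; have := floorD1_gt (x / p); rewrite rmorphD.
have [yx|yx] := leP (y * (x - f%:~R * p)) 0.
  have xp : `|x - f%:~R * p| < p by rewrite ger0_norm; lra.
  exists (- f); rewrite rmorphN/= !mulNr; split => //.
  by apply: key xp yx; rewrite -pq; ring.
have xp : `|x - (f%:~R + 1) * p| < p.
  rewrite ltr0_norm ?subr_lt0// opprB ltrBlDr.
  (* A zero residue belongs to the previous case; excluding it rules out the boundary value [-p]. *)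
  suff : x - f%:~R * p != 0 by rewrite neq_lt => /orP[]; lra.
  by apply: contraTneq yx => ->; rewrite mulr0 ltxx.
exists (- (f + 1)); rewrite rmorphN/= rmorphD/= !mulNr; split => //.
apply: key xp _; first by rewrite -pq; ring.
have : 0 < x - f%:~R * p.
  rewrite lt_neqAle subr_ge0 f1 andbT eq_sym.
  by apply: contraTneq yx => ->; rewrite mulr0 ltxx.
move=> X0; move: yx; rewrite pmulr_lgt0// => y0.
by rewrite pmulr_rle0//; lra.
Qed.

(** Dividing the coefficients by their gcd divides the norm by it, so minimality leaves only gcd
    1. *)
Lemma shortest_primitive h (m0 n0 : int) : det h = 1 -> (m0, n0) != (0, 0) ->
  (forall m n, (m, n) != (0, 0) ->
      supnorm (latv h m0 n0) <= supnorm (latv h m n)) ->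
  0 < supnorm (latv h m0 n0) ->
  gcdz m0 n0 = 1.
Proof.
move=> dt mn0 mn S0.
pose g := gcdz m0 n0.
have g0 : g != 0 by rewrite gcdz_eq0.
have /divzK mE := dvdz_gcdl m0 n0.
have /divzK nE := dvdz_gcdr m0 n0.
set m1 := (_ %/ _)%Z in mE; set n1 := (_ %/ _)%Z in nE.
have le : supnorm (latv h m0 n0) <= supnorm (latv h m1 n1).
  apply: mn; apply: contraNneq mn0 => -[m1E n1E].
  by rewrite -mE -nE m1E n1E !mul0r.
have gge : 0 <= g by [].
have gR : 0 <= g%:~R :> R by rewrite ler0z.
have E : supnorm (latv h m0 n0) = g%:~R * supnorm (latv h m1 n1).
  have E1 : (latv h m0 n0).1 = g%:~R * (latv h m1 n1).1.
    transitivity (h.1.1 * (m1 * g)%:~R + h.1.2 * (n1 * g)%:~R); first by rewrite /g mE nE.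
    by rewrite /latv/mulmv/= !rmorphM/=; ring.
  have E2 : (latv h m0 n0).2 = g%:~R * (latv h m1 n1).2.
    transitivity (h.2.1 * (m1 * g)%:~R + h.2.2 * (n1 * g)%:~R); first by rewrite /g mE nE.
    by rewrite /latv/mulmv/= !rmorphM/=; ring.
  by rewrite /supnorm E1 E2 !normrM (ger0_norm gR) maxr_pMr.
have : (g%:~R : R) <= 1.
  move: le S0; rewrite E; set S := supnorm _ => le S0.
  have Sp : 0 < S by rewrite ltNge; apply/negP => S'; move: S0; rewrite ltNge mulr_ge0_le0.
  by rewrite -(ler_pM2r Sp) mul1r.
rewrite -/g (_ : 1 = 1%:~R)// ler_int => g1.
by lia.
Qed.

(** A shortest vector longer than 1 would be beaten by a complementary basis vector reduced modulo
    it. *)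
Lemma exists_short_vector h : det h = 1 ->
  exists m n, (m, n) != (0, 0) /\ supnorm (latv h m n) <= 1.
Proof.
move=> dt; have [m0 [n0 [mn0 mn]]] := exists_shortest dt.
exists m0, n0; split => //; rewrite leNgt; apply/negP => S1.
have S0 : 0 < supnorm (latv h m0 n0) by apply: lt_trans S1.
have gE := shortest_primitive dt mn0 mn S0.
(* Bezout coefficients complete the primitive shortest vector to a basis; the second basis vector
   may be shifted by any multiple [j] of the first. *)
have [u [v uv]] := Bezoutz m0 n0; rewrite gE in uv.
have := det_latv h m0 n0 (- v) u.
rewrite dt mul1r (_ : m0 * u - - v * n0 = 1); last by rewrite -uv; ring.
rewrite mulr1z.
have nz j : (- v + j * m0, u + j * n0) != (0, 0).
  by apply/eqP => -[e1 e2]; nia.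
have {}mn j := mn _ _ (nz j); move: mn; move: S1.
have [le|/ltW le] := leP `|(latv h m0 n0).2| `|(latv h m0 n0).1|.
  rewrite {1 2}/supnorm (max_l le) => S1 mn dE.
  have [|j [j1 j2]] := companion_vector S1 le
    (x := (latv h (- v) u).1) (q := (latv h (- v) u).2).
    by rewrite -dE; ring.
  by have := mn j; rewrite latv_comb leNgt supnorm_lt j1 j2.
(* The same with coordinates exchanged. The exchange reverses orientation, so the companion is
   negated and the shift becomes [- j]. *)
rewrite {1 2}/supnorm (max_r le) => S1 mn dE.
have [|j [j1 j2]] := companion_vector S1 le
  (x := - (latv h (- v) u).2) (q := - (latv h (- v) u).1).
  by rewrite -dE; ring.
have := mn (- j); rewrite latv_comb leNgt supnorm_lt.
rewrite rmorphN/= !mulNr -[X in `|X| < _]opprB -[X in _ && (`|X| < _)]opprB.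
by rewrite !normrN ![_ * _ - _]addrC j1 j2.
Qed.

(** The matrix $\mathrm{diag}(A^{-1},A)$ has determinant 1 and maps the box onto the unit square. *)
Lemma minkowski_box h (A : R) : det h = 1 -> 0 < A ->
  exists m n, [/\ (m, n) != (0, 0), `|(latv h m n).1| <= A & `|(latv h m n).2| <= A^-1].
Proof.
move=> dt A0; have An : A != 0 by rewrite gt_eqF.
pose h' : mat R := ((A^-1 * h.1.1, A^-1 * h.1.2), (A * h.2.1, A * h.2.2)).
have dt' : det h' = 1 by rewrite -dt /det/=; field.
have [m [n [mn0]]] := exists_short_vector dt'; rewrite supnorm_le => /andP[le1 le2].
exists m, n; split => //.
  move: le1; have -> : (latv h' m n).1 = A^-1 * (latv h m n).1 by rewrite /latv/mulmv/=; ring.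
  by rewrite normrM gtr0_norm ?invr_gt0// mulrC ler_pdivrMr// mul1r.
move: le2; have -> : (latv h' m n).2 = A * (latv h m n).2 by rewrite /latv/mulmv/=; ring.
by rewrite normrM gtr0_norm// mulrC -ler_pdivlMr// div1r.
Qed.
End minkowski.

(** * Nearly critical lattices *)

Lemma int_parity (m : int) : exists k (e : bool), m = 2 * k + e%:Z.
Proof.
exists (m %/ 2)%Z, ((m %% 2)%Z == 1); have := divz_eq m 2.
have := modz_ge0 m (isT : 2 != 0 :> int).
have := ltz_mod m (isT : 2 != 0 :> int); case: eqP; lia.
Qed.

(** Modulo 2 the two vectors are linearly dependent over the field with two elements, so one of them
    or their sum vanishes. *)
Lemma det2_parity (m1 n1 m2 n2 : int) : m1 * n2 - m2 * n1 = 2 ->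
  [\/ exists k l, m1 = 2 * k /\ n1 = 2 * l,
      exists k l, m2 = 2 * k /\ n2 = 2 * l |
      exists k l, m1 + m2 = 2 * k /\ n1 + n2 = 2 * l].
Proof.
have [k1 [e1 ->]] := int_parity m1; have [l1 [f1 ->]] := int_parity n1.
have [k2 [e2 ->]] := int_parity m2; have [l2 [f2 ->]] := int_parity n2.
case: e1 e2 f1 f2 => [] [] [] [] /= h; try (exfalso; lia).
all: try (by constructor 1; exists k1, l1; split; lia).
all: try (by constructor 2; exists k2, l2; split; lia).
all: try (by constructor 3; exists (k1 + k2), (l1 + l2); split; lia).
all: try (by constructor 3; exists (k1 + k2 + 1), (l1 + l2); split; lia).
all: try (by constructor 3; exists (k1 + k2), (l1 + l2 + 1); split; lia).
all: try (by constructor 3; exists (k1 + k2 + 1), (l1 + l2 + 1); split; lia).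
Qed.

Section near_critical.
Variable R : realType.
Implicit Types (h : mat R) (r : R) (m n : int).

Lemma latvN1 h m n : (latv h (- m) (- n)).1 = - (latv h m n).1.
Proof. by rewrite /latv/mulmv/= !rmorphN/=; ring. Qed.

Lemma latvN2 h m n : (latv h (- m) (- n)).2 = - (latv h m n).2.
Proof. by rewrite /latv/mulmv/= !rmorphN/=; ring. Qed.

Lemma supnorm_latv2 h m n :
  supnorm (latv h (2 * m) (2 * n)) = 2 * supnorm (latv h m n).
Proof.
have -> : latv h (2 * m) (2 * n) = (2 * (latv h m n).1, 2 * (latv h m n).2).
  by rewrite /latv/mulmv/= !rmorphM/=; congr (_, _); ring.
by rewrite /supnorm/= !normrM ger0_norm// maxr_pMr.
Qed.

Lemma latv_half h m n m' n' k l : m + m' = 2 * k -> n + n' = 2 * l ->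
  (latv h k l).1 = ((latv h m n).1 + (latv h m' n').1) / 2 /\
  (latv h k l).2 = ((latv h m n).2 + (latv h m' n').2) / 2.
Proof.
move=> /(congr1 (fun z : int => z%:~R : R)) e1 /(congr1 (fun z : int => z%:~R : R)) e2.
move: e1 e2; rewrite !rmorphD !rmorphM/= => e1 e2.
have k2 : k%:~R = (m%:~R + m'%:~R) / 2 :> R by lra.
have l2 : l%:~R = (n%:~R + n'%:~R) / 2 :> R by lra.
by rewrite /latv/mulmv/= k2 l2; split; field.
Qed.

(** * Estimates for the Minkowski vectors [(p, y)] and [(x, q)]; [1 + 3 * r] bounds [b^-1] *)

Section near_critical_reals.
Variables (r b p y x q : R).
Hypotheses (r0 : 0 < r) (r1 : r <= 1 / 100) (bE : b = 1 - 2 * r).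
Hypotheses (p0 : b < p) (p1 : p <= 1 + 3 * r) (y1 : `|y| <= b).
Hypotheses (q0 : b < q) (q1 : q <= 1 + 3 * r) (x1 : `|x| <= b).

Let rr0 : 0 <= r * r. Proof. by rewrite mulr_ge0// ltW. Qed.

Let rr1 : r * r <= r / 100.
Proof. by have := ler_wpM2l (ltW r0) r1; lra. Qed.

Let bbE : b * b = 1 - 4 * r + 4 * (r * r). Proof. by rewrite bE; ring. Qed.

Let b0 : 0 < b. Proof. by rewrite bE; move: r1; lra. Qed.

Let xy1 : `|x * y| <= b * b. Proof. by rewrite normrM ler_pM. Qed.

Let pq1 : b * b < p * q. Proof. by rewrite ltr_pM// ltW. Qed.

Let pq2 : p * q <= 1 + 6 * r + 9 * (r * r).
Proof.
have -> : 1 + 6 * r + 9 * (r * r) = (1 + 3 * r) * (1 + 3 * r) by ring.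
by rewrite ler_pM//; move: b0 p0 q0; lra.
Qed.

(** [p * q] is near 1 and exceeds [b * b], which bounds [|x * y|]. Since the determinant will be an
    integer, only 1 and 2 remain. *)
Lemma near_critical_det : 0 < p * q - x * y < 3.
Proof.
by move: xy1 pq1 pq2 bbE rr1 r1 r0; rewrite ler_norml => /andP[]; lra.
Qed.

Lemma near_critical_det1 : p * q - x * y = 1 -> `|x * y| <= 8 * r.
Proof.
by rewrite ler_norml; move: pq1 pq2 bbE rr1 rr0 r0; lra.
Qed.

(** Determinant 2 forces $xy$ within $7r$ of $-1$ from above, hence $|x|\ge 1-7r$. According to the
    sign of [x], half of [p - x] or of [p + x] is then at most $5r$, and the other factor is at most
    $8/5$. The factors are coordinates of the half sum and half difference of the two vectors. *)
Lemma near_critical_det2 : p * q - x * y = 2 ->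
  `|(p + x) / 2 * ((y - q) / 2)| <= 8 * r \/ `|(p - x) / 2 * ((y + q) / 2)| <= 8 * r.
Proof.
move=> dE.
have xyE : 1 - 7 * r <= `|x * y|.
  by rewrite ler_normr; apply/orP; right; move: pq2 rr1 dE r0; lra.
have x2 : 1 - 7 * r <= `|x|.
  have : `|x| * `|y| <= `|x| * 1 by rewrite ler_wpM2l//; move: y1 r0; rewrite bE; lra.
  by move: xyE; rewrite normrM; lra.
have bnd (u v w : R) : `|u| <= 5 * r -> `|v| <= 1 -> `|w| <= 1 + 3 * r ->
    `|u * ((v + w) / 2)| <= 8 * r.
  move=> u5 v1 w1; rewrite normrM.
  have vw : `|(v + w) / 2| <= 8 / 5.
    rewrite normrM (@ger0_norm _ 2^-1) ?invr_ge0//.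
    by have := ler_normD v w; move: v1 w1 r1; lra.
  have -> : 8 * r = (5 * r) * (8 / 5) by field.
  exact: ler_pM.
have q0' : `|q| <= 1 + 3 * r by rewrite ger0_norm//; move: q0 b0; lra.
have y1' : `|y| <= 1 by move: y1 r0; rewrite bE; lra.
have [x0|x0] := leP 0 x; [right|left]; apply: bnd => //; rewrite ?normrN//.
  move: x1 x2; rewrite (ger0_norm x0) ler_norml => ? ?; move: p0 p1 r0 bE; lra.
move: x1 x2; rewrite (ltr0_norm x0) ler_norml => ? ?; move: p0 p1 r0 bE; lra.
Qed.
End near_critical_reals.

(** A first coordinate is paired with a second coordinate so that the product is unchanged by the
    diagonal flow; the norm bounds later restrict the coefficients to a finite set. *)
Definition near_flat h (r : R) := exists m n m' n',
  [/\ (m, n) != (0, 0), (m', n') != (0, 0),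
      `|(latv h m n).1 * (latv h m' n').2| <= 8 * r,
      supnorm (latv h m n) <= 2 & supnorm (latv h m' n') <= 2].

Lemma near_critical h r : det h = 1 -> 0 < r -> r <= 1 / 100 ->
  (forall m n, (m, n) != (0, 0) -> 1 - 2 * r < supnorm (latv h m n)) ->
  near_flat h r.
Proof.
move=> dt r0 r1; have [b bE] : exists b : R, b = 1 - 2 * r by exists (1 - 2 * r).
rewrite -bE => hmin.
have rr1 : r * r <= r / 100 by have := ler_wpM2l (ltW r0) r1; lra.
have b0 : 0 < b by lra.
have bV : b^-1 <= 1 + 3 * r.
  by rewrite invf_ple ?posrE//; [rewrite -div1r ler_pdivrMr; [rewrite bE; lra|lra] | lra].
have bVE : (b^-1)^-1 = b by rewrite invrK.
have bV0 : 0 < b^-1 by rewrite invr_gt0.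
(* In the box $b^{-1}\times b$ the second coordinate is at most [b], so the lower bound on the norm
   falls on the first; a change of sign makes it positive. *)
have [m1 [n1 [mn1 p1 y1 p0]]] : exists m n, [/\ (m, n) != (0, 0),
    (latv h m n).1 <= 1 + 3 * r, `|(latv h m n).2| <= b & b < (latv h m n).1].
  have [m [n [mn]]] := minkowski_box dt bV0; rewrite bVE => X Y.
  have := hmin _ _ mn; rewrite ltNge supnorm_le Y andbT -ltNge => bX.
  have [X0|X0] := ltP 0 (latv h m n).1.
    by exists m, n; move: bX X; rewrite (gtr0_norm X0) => bX X; split => //; lra.
  exists (- m), (- n); rewrite latvN1 latvN2 normrN.
  move: bX X; rewrite (ler0_norm X0) => bX X.
  by split => //; [move: mn; rewrite !xpair_eqE !oppr_eq0 | lra].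
have [m2 [n2 [mn2 q1 x1 q0]]] : exists m n, [/\ (m, n) != (0, 0),
    (latv h m n).2 <= 1 + 3 * r, `|(latv h m n).1| <= b & b < (latv h m n).2].
  have [m [n [mn X Y]]] := minkowski_box dt b0.
  have := hmin _ _ mn; rewrite ltNge supnorm_le X andTb -ltNge => bX.
  have [X0|X0] := ltP 0 (latv h m n).2.
    by exists m, n; move: bX Y; rewrite (gtr0_norm X0) => bX Y; split => //; lra.
  exists (- m), (- n); rewrite latvN1 latvN2 normrN.
  move: bX Y; rewrite (ler0_norm X0) => bX Y.
  by split => //; [move: mn; rewrite !xpair_eqE !oppr_eq0 | lra].
have := det_latv h m1 n1 m2 n2; rewrite dt mul1r.
have det1 := near_critical_det1 r0 r1 bE p0 p1 q0 q1
  (x := (latv h m2 n2).1) (y := (latv h m1 n1).2).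
have det2 := near_critical_det2 r0 r1 bE p0 p1 y1 q0 q1 x1.
move: (near_critical_det r0 r1 bE p0 p1 y1 q0 q1 x1) => /andP[].
move=> + + dE; rewrite dE => D0 D3; rewrite dE in det1 det2.
have sn1 : supnorm (latv h m1 n1) <= 103 / 100.
  rewrite supnorm_le gtr0_norm ?(lt_trans b0)//.
  by apply/andP; split; [apply: le_trans p1 _|apply: le_trans y1 _];
    move: r1 r0; rewrite ?bE; lra.
have sn2 : supnorm (latv h m2 n2) <= 103 / 100.
  rewrite supnorm_le [X in _ && (X <= _)]gtr0_norm ?(lt_trans b0)//.
  by apply/andP; split; [apply: le_trans x1 _|apply: le_trans q1 _];
    move: r1 r0; rewrite ?bE; lra.
have to2 v : supnorm v <= 103 / 100 -> supnorm v <= 2 :> R.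
  by move=> /le_trans; apply; lra.
have {D0 D3}[D1|D2] : m1 * n2 - m2 * n1 = 1 \/ m1 * n2 - m2 * n1 = 2.
  move: D0 D3; rewrite (_ : 3 = 3%:~R :> R)// (_ : 0 = 0%:~R :> R)// !ltr_int.
  by clear; lia.
  exists m2, n2, m1, n1; split; [by []| by []| |exact: to2|exact: to2].
  by apply: det1; rewrite D1.
have {}hmin (k l : int) : (k, l) != (0, 0) -> 98 / 100 < supnorm (latv h k l).
  by move=> /hmin; apply: le_lt_trans; move: r1; rewrite bE; lra.
(* Twice a nonzero lattice vector has norm above 196/100, so neither Minkowski vector is even and
   parity selects their sum. *)
have half (k l : int) : (2 * k, 2 * l) != (0, 0) ->
    103 / 100 < supnorm (latv h (2 * k) (2 * l)).
  move=> kl0; have kl : (k, l) != (0, 0).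
    by apply: contraNneq kl0 => -[-> ->]; rewrite mulr0.
  by rewrite supnorm_latv2; have := hmin _ _ kl; lra.
case: (det2_parity D2) => [[k [l [kE lE]]]|[k [l [kE lE]]]|[k [l [kE lE]]]].
- by exfalso; have := half k l; rewrite -kE -lE => /(_ mn1); rewrite ltNge sn1.
- by exfalso; have := half k l; rewrite -kE -lE => /(_ mn2); rewrite ltNge sn2.
(* The half difference is the half sum minus the second vector, so it is a lattice vector too. *)
have kE' : m1 + (- m2) = 2 * (k - m2) by move: kE; clear; lia.
have lE' : n1 + (- n2) = 2 * (l - n2) by move: lE; clear; lia.
have [vE1 vE2] := latv_half h kE lE; have [uE1 uE2] := latv_half h kE' lE'.
rewrite latvN1 in uE1; rewrite latvN2 in uE2.
have kl : (k, l) != (0, 0).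
  by apply/negP => /eqP[k0 l0]; rewrite k0 l0 in kE lE; move: kE lE D2; clear; nia.
have kl' : (k - m2, l - n2) != (0, 0).
  apply/negP => /eqP[k0 l0]; rewrite k0 l0 in kE' lE'; move: kE' lE' D2; clear; nia.
have half_le (u v : R) : `|u| <= 103 / 100 -> `|v| <= 103 / 100 ->
    `|(u + v) / 2| <= 2.
  by clear; rewrite !ler_norml; lra.
move: (sn1) (sn2); rewrite !supnorm_le => /andP[P1 Y1] /andP[X1 Q1].
have snv : supnorm (latv h k l) <= 2 by rewrite supnorm_le vE1 vE2 !half_le.
have snu : supnorm (latv h (k - m2) (l - n2)) <= 2.
  by rewrite supnorm_le uE1 uE2 !half_le ?normrN.
have [] := det2; first by rewrite D2.
  by exists k, l, (k - m2), (l - n2); split; rewrite ?vE1 ?uE2.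
by exists (k - m2), (l - n2), k, l; split; rewrite ?vE2 ?uE1.
Qed.
End near_critical.

(** * The upper bound *)

Section upper_contain.
Variable R : realType.
Implicit Types (g h : mat R) (r : R) (m n : int).

(** From $e^{-s/2}\ge 1-s/2\ge 1/2$, by inverting and squaring. *)
Lemma expR_le4 (s : R) : s <= 1 -> expR s <= 4.
Proof.
move=> s1; have : 1 / 2 <= expR (- s / 2).
  by apply: le_trans (expR_ge1Dx _); lra.
have -> : - s / 2 = - (s / 2) by lra.
have -> : s = s / 2 + s / 2 by lra.
rewrite expRD expRN.
have -> : (s / 2 + s / 2) / 2 = s / 2 by lra.
set e := expR _; have e0 : 0 < e by exact: expR_gt0.
rewrite -[e^-1]div1r ler_pdivlMr// => e2.
by have := ler_pM (ltW e0) (ltW e0) (_ : e <= 2) (_ : e <= 2); rewrite -natrM; apply; lra.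
Qed.

Lemma ler_normsq (x y : R) : 0 <= y -> x ^+ 2 <= y ^+ 2 -> `|x| <= y.
Proof. by move=> y0; rewrite -[x ^+ 2]real_normK ?num_real// ler_pXn2r ?nnegrE. Qed.

Lemma latv_eq0 h m n : det h = 1 -> latv h m n = (0, 0) -> (m, n) = (0, 0).
Proof.
move=> dt e; have : supnorm (latv h m n) <= 0 by rewrite e supnorm_le/= normr0 lexx.
move=> /(latv_coord_bound dt)[]; rewrite !mul0r.
by rewrite !lerz0 !normr_le0 => /eqP -> /eqP ->.
Qed.

(** Lagrange's identity $n_1n_2=\det^2+\langle v_1,v_2\rangle^2$, where reduction bounds the last
    term by $n_1^2/4\le n_1n_2/4$. *)
Lemma reduced_n1n2 g : reduced g ->
  3 * ((g.1.1 ^+ 2 + g.2.1 ^+ 2) * (g.1.2 ^+ 2 + g.2.2 ^+ 2)) <= 4 * det g ^+ 2.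
Proof.
case: g => [[a b] [c d]]; rewrite /reduced /det /= => -[n12 ip].
have : (2 * (a * b + c * d)) ^+ 2 <= (a ^+ 2 + c ^+ 2) ^+ 2.
  rewrite -[leLHS]real_normK ?num_real// normrM ger0_norm//.
  by rewrite ler_pXn2r ?nnegrE// ?mulr_ge0 ?addr_ge0 ?sqr_ge0.
have : (a ^+ 2 + c ^+ 2) ^+ 2 <= (a ^+ 2 + c ^+ 2) * (b ^+ 2 + d ^+ 2).
  by rewrite expr2 ler_wpM2l// addr_ge0 ?sqr_ge0.
have -> : (a ^+ 2 + c ^+ 2) * (b ^+ 2 + d ^+ 2) =
    (a * d - b * c) ^+ 2 + (a * b + c * d) ^+ 2 by ring.
rewrite exprMn; lra.
Qed.

(* [a_s] applied to [t^-1 g], with [u = expR s]. *)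
Definition flow_basis (u t : R) g : mat R :=
  ((u / t * g.1.1, u / t * g.1.2), ((u * t)^-1 * g.2.1, (u * t)^-1 * g.2.2)).

Lemma det_flow_basis (u t : R) g : u != 0 -> t != 0 -> t ^+ 2 = det g ->
  det (flow_basis u t g) = 1.
Proof.
move=> u0 t0 tE; have : det (flow_basis u t g) = det g / t ^+ 2.
  by rewrite /det/=; field; rewrite u0 t0.
by rewrite -tE divff// expf_neq0.
Qed.

Lemma latv_flow1 (u t : R) g m n :
  (latv (flow_basis u t g) m n).1 = u / t * (latv g m n).1.
Proof. by rewrite /latv/mulmv/=; ring. Qed.

Lemma latv_flow2 (u t : R) g m n :
  (latv (flow_basis u t g) m n).2 = (u * t)^-1 * (latv g m n).2.
Proof. by rewrite /latv/mulmv/=; ring. Qed.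

(** With $u=e^s$, the flow moves the lattice into [K_ r], where nonzero vectors have norm at least
    $e^{-r}\ge 1-r>1-2r$. *)
Lemma Ucyl_min g r (t : R) : 0 < r -> 0 < t -> t ^+ 2 = det g ->
  Ucyl r (latt (scalemat t^-1 g)) -> exists u, [/\ 1 <= u, u <= 4 &
  forall m n, (m, n) != (0, 0) ->
    1 - 2 * r < supnorm (latv (flow_basis u t g) m n)].
Proof.
move=> r0 t0 tE [s [s0 [s1 [L' [_ [_ DL]] LE]]]].
have tn0 : t != 0 by rewrite gt_eqF.
have u0 : 0 < expR s by exact: expR_gt0.
have un0 : expR s != 0 by rewrite gt_eqF.
exists (expR s); split; [by rewrite -expR0 ler_expR | exact/expR_le4/ltW |].
move=> m n mn0; set v := latv _ _ _.
have L'v : L' v.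
  have : latt (scalemat t^-1 g) (latv (scalemat t^-1 g) m n) by exists m, n.
  rewrite LE => -[v' L'v' [e1 e2]].
  suff -> : v = v' by [].
  rewrite (surjective_pairing v') (surjective_pairing v); congr (_, _).
    rewrite latv_flow1 -[RHS](mulVKf un0) -expRN.
    move: e1 => /=; rewrite mul0r addr0 => ->.
    by rewrite /latv/mulmv/=; field.
  rewrite latv_flow2 -[RHS](mulKf un0).
  move: e2 => /=; rewrite mul0r add0r opprK => ->.
  by rewrite /latv/mulmv/= invfM; ring.
have v0 : v <> (0, 0).
  by move=> /(latv_eq0 (det_flow_basis un0 tn0 tE)) mnE; rewrite mnE eqxx in mn0.
have sv : 0 < supnorm v.
  rewrite ltNge supnorm_le !normr_le0; apply/negP => /andP[/eqP e1 /eqP e2].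
  by apply: v0; rewrite (surjective_pairing v) e1 e2.
have : ((ln (supnorm v)^-1)%:E <= r%:E)%E.
  by apply: le_trans DL; apply: ereal_sup_ubound; exists v.
rewrite lee_fin lnV ?posrE// lerNl => lnv.
have : expR (- r) <= supnorm v by rewrite -[leRHS]lnK ?posrE// ler_expR.
by have := expR_ge1Dx (- r); lra.
Qed.

Lemma max_gt_or (x y z : R) : z < Num.max x y -> z < x \/ z < y.
Proof. by rewrite lt_max => /orP. Qed.

(** Undoing the flow, the first basis vector has length at least $t/5$. Then $n_1n_2\le\frac43t^4$
    gives $n_2\le\frac{100}{3}t^2\le(6t)^2$, and $n_1\le n_2$. *)
Lemma reduced_entries_bound g (u t : R) : 0 < t -> t ^+ 2 = det g -> reduced g ->
  1 <= u -> u <= 4 -> 98 / 100 < supnorm (latv (flow_basis u t g) 1 0) ->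
  [/\ `|g.1.1| <= 6 * t, `|g.1.2| <= 6 * t, `|g.2.1| <= 6 * t & `|g.2.2| <= 6 * t].
Proof.
move=> t0 tE rg u1 u4 min.
have u0 : 0 < u by lra.
have [n12 _] := rg.
have n1 : t ^+ 2 / 25 <= g.1.1 ^+ 2 + g.2.1 ^+ 2.
  have -> : t ^+ 2 / 25 = (t / 5) ^+ 2 by field.
  move: min; rewrite /supnorm latv_flow1 latv_flow2 => /max_gt_or.
  have -> : (latv g 1 0).1 = g.1.1 by rewrite /latv/mulmv/= mulr1z mulr0z; ring.
  have -> : (latv g 1 0).2 = g.2.1 by rewrite /latv/mulmv/= mulr1z mulr0z; ring.
  rewrite !normrM !normfV gtr0_norm// (gtr0_norm t0) (gtr0_norm (mulr_gt0 u0 t0)).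
  case=> lt.
    have : t / 5 <= `|g.1.1|.
      move: lt; rewrite mulrAC ltr_pdivlMr// => lt.
      have : u * `|g.1.1| <= 4 * `|g.1.1| by rewrite ler_wpM2r.
      by lra.
    rewrite -(ler_pXn2r (_ : 0 < 2)%N) ?nnegrE//; last by rewrite divr_ge0// ltW.
    by rewrite real_normK ?num_real//; have := sqr_ge0 g.2.1; lra.
  have : t / 5 <= `|g.2.1|.
    move: lt; rewrite [(u * t)^-1 * _]mulrC ltr_pdivlMr ?mulr_gt0// => lt.
    have : 1 * t <= u * t by rewrite ler_wpM2r// ltW.
    by lra.
  rewrite -(ler_pXn2r (_ : 0 < 2)%N) ?nnegrE//; last by rewrite divr_ge0// ltW.
  by rewrite real_normK ?num_real//; have := sqr_ge0 g.1.1; lra.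
have T0 : 0 < t ^+ 2 by rewrite exprn_gt0.
have := reduced_n1n2 rg; rewrite -tE.
set N1 := _ + _ in n1 n12 *; set N2 := _ + g.2.2 ^+ 2 in n12 * => N12.
have n2 : N2 <= (6 * t) ^+ 2.
  have N20 : 0 <= N2 by rewrite addr_ge0 ?sqr_ge0.
  have : 3 * (t ^+ 2 / 25 * N2) <= 4 * (t ^+ 2) ^+ 2.
    by apply: le_trans N12; rewrite ler_pM2l// ler_wpM2r.
  have -> : 3 * (t ^+ 2 / 25 * N2) = t ^+ 2 * (3 / 25 * N2) by ring.
  have -> : 4 * (t ^+ 2) ^+ 2 = t ^+ 2 * (4 * t ^+ 2) by ring.
  by rewrite ler_pM2l// exprMn; lra.
have t6 : 0 <= 6 * t by rewrite mulr_ge0// ltW.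
have := sqr_ge0 g.1.1; have := sqr_ge0 g.1.2; have := sqr_ge0 g.2.1; have := sqr_ge0 g.2.2.
move=> h1 h2 h3 h4; rewrite /N1 /N2 in n12 n2.
by split; apply: ler_normsq => //; apply: le_trans n2; lra.
Qed.

(** Cramer's rule with $60=2\cdot6+8\cdot6$. *)
Lemma int_bound_cramer (D X Y p q : R) (t : R) m : 0 < t -> t ^+ 2 = D ->
  D * m%:~R = X * p - Y * q -> `|X| <= 2 * t -> `|Y| <= 8 * t ->
  `|p| <= 6 * t -> `|q| <= 6 * t -> `|m| <= 60.
Proof.
move=> t0 tE mE X2 Y8 p6 q6.
have : `|D * m%:~R| <= 60 * t ^+ 2.
  rewrite mE (le_trans (ler_normB _ _))// !normrM.
  have -> : 60 * t ^+ 2 = 2 * t * (6 * t) + 8 * t * (6 * t) by ring.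
  by rewrite lerD// ler_pM.
have D0 : 0 < D by rewrite -tE exprn_gt0.
rewrite tE normrM gtr0_norm// mulrC ler_pM2r// -intr_norm.
by rewrite (_ : 60 = 60%:~R :> R)// ler_int.
Qed.

(** Transports [near_flat] from the flowed normalised basis back to [g]: with $1\le u\le4$ the norm
    bound 2 becomes $2t$ and $8t$ on the coordinates, while the product only gains the factor
    $t^2\le1$. *)
Lemma FDcone_Ucyl_sub g r : 0 < r -> r <= 1 / 100 -> FDcone (Ucyl r) g ->
  [/\ `|g.1.1| <= 6, `|g.1.2| <= 6, `|g.2.1| <= 6 & `|g.2.2| <= 6] /\
  exists m n m' n',
  [/\ [/\ (m, n) != (0, 0), `|m| <= 60 & `|n| <= 60],
      [/\ (m', n') != (0, 0), `|m'| <= 60 & `|n'| <= 60],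
      `|(latv g m n).1| <= 8, `|(latv g m' n').2| <= 8 &
      `|(latv g m n).1 * (latv g m' n').2| <= 8 * r].
Proof.
move=> r0 r1 [D0 [D1 [rg Ug]]].
set t := Num.sqrt (det g) in Ug.
have t0 : 0 < t by rewrite sqrtr_gt0.
have tE : t ^+ 2 = det g by rewrite sqr_sqrtr// ltW.
have t1 : t <= 1 by rewrite -sqrtr1 ler_wsqrtr.
clearbody t.
have [u [u1 u4 umin]] := Ucyl_min r0 t0 tE Ug.
have u0 : 0 < u by lra.
have dt : det (flow_basis u t g) = 1 by apply: det_flow_basis => //; rewrite gt_eqF.
have [a6 b6 c6 d6] : [/\ `|g.1.1| <= 6 * t, `|g.1.2| <= 6 * t,
    `|g.2.1| <= 6 * t & `|g.2.2| <= 6 * t].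
  apply: (@reduced_entries_bound g u) => //.
  by apply: le_lt_trans (umin 1 0 _) => //; lra.
split; first by split; lra.
have [m [n [m' [n' [mn mn' XY S S']]]]] := near_critical dt r0 r1 umin.
have bnd k l : supnorm (latv (flow_basis u t g) k l) <= 2 ->
    [/\ `|(latv g k l).1| <= 2 * t, `|(latv g k l).2| <= 8 * t, `|k| <= 60 & `|l| <= 60].
  rewrite supnorm_le latv_flow1 latv_flow2 => /andP[].
  rewrite !normrM !normfV (gtr0_norm u0) (gtr0_norm t0) (gtr0_norm (mulr_gt0 u0 t0)).
  rewrite mulrAC ler_pdivrMr// mulrC => X2.
  rewrite mulrC ler_pdivrMr ?mulr_gt0// => Y2.
  have X : `|(latv g k l).1| <= 2 * t.
    by apply: le_trans X2; rewrite ler_peMr.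
  have Y : `|(latv g k l).2| <= 8 * t.
    by apply: le_trans Y2 _; rewrite mulrA ler_pM2r//; lra.
  split => //.
    apply: (int_bound_cramer t0 tE _ X Y d6 b6).
    by rewrite /det/latv/mulmv/=; ring.
  rewrite -normrN.
  apply: (int_bound_cramer t0 tE _ X Y c6 a6).
  by rewrite rmorphN /det/latv/mulmv/=; ring.
have [X1 _ mb nb] := bnd _ _ S; have [_ Y1 mb' nb'] := bnd _ _ S'.
exists m, n, m', n'; split => //; [lra|lra|].
apply: le_trans XY; rewrite latv_flow1 latv_flow2.
have -> : u / t * (latv g m n).1 * ((u * t)^-1 * (latv g m' n').2) =
  (t ^+ 2)^-1 * ((latv g m n).1 * (latv g m' n').2).
  by field; rewrite !gt_eqF.
by rewrite tE [leRHS]normrM gtr0_norm ?invr_gt0// ler_peMl// invf_ge1.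
Qed.
End upper_contain.

Lemma measurable_set_le (d : measure_display) (T : measurableType d) (R : realType)
    (f g : T -> R) : measurable_fun setT f -> measurable_fun setT g ->
  measurable [set x | f x <= g x].
Proof.
move=> mf mg; have := measurable_fun_ler mf mg measurableT (Y := [set true]).
by rewrite setTI; apply.
Qed.

Lemma measure_bigsetU_le (d : measure_display) (T : measurableType d) (R : realType)
    (m : {measure set T -> \bar R}) (I : Type) (s : seq I) (A : I -> set T) (k : R) :
  (forall i, measurable (A i)) -> (forall i, (m (A i) <= k%:E)%E) ->
  (m (\big[setU/set0]_(i <- s) A i) <= ((size s)%:R * k)%:E)%E.
Proof.
move=> mA Ak; elim: s => [|i s IH]; first by rewrite big_nil measure0 mul0r.
rewrite big_cons; apply: le_trans.
  by apply: measureU2 => //; exact: bigsetU_measurable.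
by rewrite /= -natr1 mulrDl mul1r addrC EFinD leeD.
Qed.

(** * Areas of strips in the plane of one matrix row *)

Section strips.
Variable R : realType.
Local Notation leb := (@lebesgue_measure R).
Local Notation leb2 := (leb \x leb)%E.
Local Notation RR := (measurableTypeR R * measurableTypeR R)%type.

(** The point is a row of a basis matrix, and the linear form is the corresponding coordinate of the
    lattice vector with coefficients [p]; 6 bounds the reduced entries. *)
Definition strip (e : R) (p : int * int) : set RR :=
  [set x | [/\ `|x.1| <= 6, `|x.2| <= 6 & `|p.1%:~R * x.1 + p.2%:~R * x.2| <= e]].

Lemma measurable_strip e p : measurable (strip e p).
Proof.
have -> : strip e p = [set x : RR | `|x.1| <= 6] `&` ([set x : RR | `|x.2| <= 6] `&`
    [set x : RR | `|p.1%:~R * x.1 + p.2%:~R * x.2| <= e]).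
  by apply/seteqP; split=> x /=; [case=> *; split|case=> ? [? ?]; split].
have m1 : measurable_fun setT (fun x : RR => x.1) by exact: measurable_fst.
have m2 : measurable_fun setT (fun x : RR => x.2) by exact: measurable_snd.
apply: measurableI; last apply: measurableI.
- apply: (@measurable_set_le _ RR); last exact: measurable_cst.
  exact: measurableT_comp.
- apply: (@measurable_set_le _ RR); last exact: measurable_cst.
  exact: measurableT_comp.
- apply: (@measurable_set_le _ RR); last exact: measurable_cst.
  apply: measurableT_comp => //; apply: measurable_funD; exact: measurable_funM.
Qed.

(** A nonzero integer coefficient is at least 1 in absolute value, so its variable is confined to
    length [2 * e] while the other ranges over length 12. *)
Lemma strip_le e p : 0 <= e -> p != (0, 0) -> (leb2 (strip e p) <= (24 * e)%:E)%E.
Proof.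
case: p => m n e0 mn0.
have [n0|n0] := eqVneq n 0.
  have m0 : m != 0 by move: mn0; rewrite n0 xpair_eqE eqxx andbT.
  have m1 : 1 <= `|m%:~R| :> R.
    by rewrite -intr_norm (_ : 1 = 1%:~R)// ler_int; move: m0; clear; lia.
  apply: (@le_trans _ _ (12%:E * leb `[(- e)%R, e])%E).
  apply: product_measure_le_sections => //.
  - move=> [a b] [/= _ _]; rewrite n0 mul0r addr0 in_itv/= -ler_norml normrM.
    by apply: le_trans; rewrite ler_peMl.
  - move=> a _; apply: (@le_trans _ _ (leb `[-6, 6])).
      by apply: le_lebesgue => b [/= _ + _]; rewrite in_itv/= ler_norml.
    by rewrite leb_itv ?lee_fin; lra.
  by rewrite leb_itv -?EFinM ?lee_fin; lra.
have n1 : 1 <= `|n%:~R| :> R.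
  by rewrite -intr_norm (_ : 1 = 1%:~R)// ler_int; move: n0; clear; lia.
apply: (@le_trans _ _ ((2 * e)%:E * leb `[(-6)%R, 6%R])%E).
apply: product_measure_le_sections => //.
- by rewrite mulr_ge0.
- by move=> [a b] [/= + _ _]; rewrite in_itv/= ler_norml.
- move=> a _; apply: (@le_trans _ _ (leb [set b | `|n%:~R * b + m%:~R * a| <= e])).
    by apply: le_lebesgue => b [/= _ _]; rewrite addrC.
  apply: le_trans; first by apply: lebesgue_abs_affine_le; rewrite ?intr_eq0.
  by rewrite lee_fin ler_pdivrMr ?(lt_le_trans ltr01)// ler_peMr// mulr_ge0.
by rewrite leb_itv -?EFinM ?lee_fin; lra.
Qed.

Lemma exists_int_pairs (N : nat) : exists s : seq (int * int),
  (0, 0) \notin s /\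
  forall m n, (m, n) != (0, 0) -> `|m| <= N%:Z -> `|n| <= N%:Z -> (m, n) \in s.
Proof.
pose ints := [seq k%:Z - N%:Z | k <- iota 0 (N + N).+1].
exists [seq p <- [seq (m, n) | m <- ints, n <- ints] | p != (0, 0)].
split=> [|m n mn mN nN]; first by rewrite mem_filter eqxx.
have mem_ints (k : int) : `|k| <= N%:Z -> k \in ints.
  move=> kN; apply/mapP; exists `|(k + N%:Z)%R|%N; last by move: kN; clear; lia.
  by rewrite mem_iota; move: kN; clear; lia.
by rewrite mem_filter mn; apply/allpairsP; exists (m, n); split => //; exact: mem_ints.
Qed.

Definition strips (s : seq (int * int)) (e : R) : set RR :=
  \big[setU/set0]_(p <- s) strip e p.

Lemma measurable_strips s e : measurable (strips s e).
Proof. by apply: bigsetU_measurable => p _; exact: measurable_strip. Qed.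

Lemma strips_le s e : (0, 0) \notin s -> 0 <= e ->
  (leb2 (strips s e) <= ((size s)%:R * (24 * e))%:E)%E.
Proof.
(* The union bound asks for an estimate at every index, so the degenerate pair gets the empty
   set. *)
move=> s0 e0; pose A p := if p == (0, 0) then set0 else strip e p.
have -> : strips s e = \big[setU/set0]_(p <- s) A p.
  apply: eq_big_seq => p ps; rewrite /A; case: eqP => // p0.
  by rewrite -p0 ps in s0.
apply: measure_bigsetU_le => p; rewrite /A.
  by case: ifP => // _; exact: measurable_strip.
case: ifPn => [_|p0]; last exact: strip_le.
by rewrite measure0 lee_fin mulr_ge0.
Qed.
End strips.

(** * Decomposition of the hyperbolic region into scales *)

Section upper.
Variable R : realType.

(** Take the last scale with $|x|\le8e^{-k}$. Below [K], failure at $k+1$ gives $|y|<re^{k+1}\le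
    4re^k$; at [K] the bound $|y|\le8$ suffices. *)
Lemma scale_select (x y r : R) (K : nat) : 0 < r -> `|x| <= 8 -> `|y| <= 8 ->
  `|x * y| <= 8 * r -> 1 <= r * expR K%:R ->
  exists2 k : nat, (k <= K)%N & `|x| <= 8 * expR (- k%:R) /\ `|y| <= 8 * r * expR k%:R.
Proof.
move=> r0 x8 y8 xy rK.
suff [xK|[k [kK k1 k2]]] : `|x| <= 8 * expR (- K%:R) \/ exists k, [/\ (k < K)%N,
    `|x| <= 8 * expR (- k%:R) & `|y| <= 8 * r * expR k%:R].
- exists K => //; split => //; apply: le_trans y8 _.
  by rewrite -mulrA; lra.
- by exists k => //; exact: ltnW.
elim: K {rK} => [|K IH]; first by left; rewrite oppr0 expR0 mulr1.
case: IH => [xK|[k [kK k1 k2]]]; last by right; exists k; split=> //; exact: ltnW.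
have [xS|xS] := leP `|x| (8 * expR (- K.+1%:R)); first by left.
right; exists K; split => //.
have e4 := @expR_le4 R _ (lexx 1); have eK := expR_gt0 (K%:R : R).
have SK : expR (K.+1%:R : R) <= 4 * expR K%:R by rewrite -natr1 expRD mulrC ler_pM2r.
have X0 : 0 < `|x| by apply: lt_trans xS; rewrite mulr_gt0// expR_gt0.
have S0 := expR_gt0 (K.+1%:R : R).
have {}xS : 8 < `|x| * expR K.+1%:R by rewrite -ltr_pdivrMr// -expRN.
have : 8 * `|y| <= `|x| * `|y| * expR K.+1%:R.
  by rewrite mulrAC ler_wpM2r// ltW.
rewrite -normrM; have := ler_wpM2r (ltW S0) xy.
have := ler_wpM2l (_ : 0 <= 8 * r) SK; rewrite mulr_ge0 ?(ltW r0)// => /(_ isT).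
have : 0 <= r * expR K%:R by rewrite mulr_ge0// ltW.
by rewrite -!mulrA; lra.
Qed.

(** The two coordinates of a lattice vector involve different rows of the matrix, so each scale
    contributes a product of strips. *)
Lemma FDcone_Ucyl_cover (r : R) (K : nat) s : 0 < r -> r <= 1 / 100 ->
  1 <= r * expR K%:R ->
  (forall m n, (m, n) != (0, 0) -> `|m| <= 60 -> `|n| <= 60 -> (m, n) \in s) ->
  FDcone (Ucyl r) `<=` \big[setU/set0]_(k <- iota 0 K.+1)
    (strips s (8 * expR (- k%:R)) `*` strips s (8 * r * expR k%:R)).
Proof.
move=> r0 r1 rK ss g /(FDcone_Ucyl_sub r0 r1)[[a6 b6 c6 d6]].
move=> [m [n [m' [n' [[mn mb nb] [mn' mb' nb'] X8 Y8 XY]]]]].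
have [k kK [k1 k2]] := scale_select r0 X8 Y8 XY rK.
rewrite -bigcup_seq; exists k.
  have : k \in iota 0 K.+1 by rewrite mem_iota ltnS.
  by [].
split; rewrite /strips -bigcup_seq.
  exists (m, n); first exact: ss.
  by split => //; rewrite mulrC [_ * g.1.2]mulrC.
exists (m', n'); first exact: ss.
by split => //; rewrite mulrC [_ * g.2.2]mulrC.
Qed.

(** Since $e^2\le16\le100$. This lets $\ln(1/r)$ absorb additive constants. *)
Lemma ln_inv_ge2 (r : R) : 0 < r -> r <= 1 / 100 -> 2 <= ln r^-1.
Proof.
move=> r0 r1; rewrite -(@expRK R 2) ler_ln ?posrE ?expR_gt0 ?invr_gt0//.
have -> : 2 = 1 + 1 :> R by lra.
rewrite expRD; have e4 := @expR_le4 R _ (lexx 1); have e0 := expR_gt0 (1 : R).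
apply: (@le_trans _ _ (4 * 4)); first exact: (ler_pM (ltW e0) (ltW e0) e4 e4).
rewrite -[r^-1]div1r ler_pdivlMr//; lra.
Qed.

Lemma leb4_FDcone_Ucyl_le : exists2 C : R, 0 < C & forall r, 0 < r -> r <= 1 / 100 ->
  (leb4 (FDcone (Ucyl r)) <= (C * (r * ln r^-1))%:E)%E.
Proof.
have [s [s0 ss]] := exists_int_pairs 60.
pose c : R := (size s)%:R * 24.
have c0 : 0 <= c by rewrite mulr_ge0.
(* Each product of strips has measure at most $64c^2r$ at every scale, and there are
   $K+1\le2\ln(1/r)$ scales; the summand 1 secures positivity. *)
exists (128 * (c * c) + 1); first by rewrite ltr_pwDr// !mulr_ge0.
move=> r r0 r1; have L2 := ln_inv_ge2 r0 r1.
pose K := (Num.truncn (ln r^-1)).+1.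
have LK : ln r^-1 <= K%:R by rewrite ltW// truncnS_gt.
have KL : K%:R <= ln r^-1 + 1 by rewrite -natr1 lerD2r truncn_le; lra.
have rK : 1 <= r * expR K%:R.
  have : r^-1 <= expR K%:R by rewrite -[r^-1]lnK ?posrE ?invr_gt0// ler_expR.
  by rewrite -[r^-1]div1r ler_pdivrMr// mulrC.
apply: le_trans; first exact/le_leb4/(FDcone_Ucyl_cover r0 r1 rK ss).
apply: (@le_trans _ _ (((size (iota 0 K.+1))%:R * (64 * (c * c) * r))%:E)).
  rewrite leb4E; apply: measure_bigsetU_le => k.
    by apply: measurableX; exact: measurable_strips.
  rewrite lebesgue4X; [|exact: measurable_strips|exact: measurable_strips].
  have e0 := expR_gt0 (k%:R : R); have e0' := expR_gt0 (- k%:R : R).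
  apply: le_trans.
    apply: lee_pmul; [exact: measure_ge0|exact: measure_ge0| |].
      by apply: strips_le => //; rewrite mulr_ge0// ltW.
    by apply: strips_le => //; rewrite !mulr_ge0// ltW.
  rewrite -EFinM lee_fin.
  have -> : (size s)%:R * (24 * (8 * expR (- k%:R))) *
     ((size s)%:R * (24 * (8 * r * expR k%:R)))
     = 64 * (c * c) * r * (expR (- k%:R) * expR k%:R) :> R by rewrite /c; ring.
  by rewrite -expRD addNr expR0 mulr1.
rewrite lee_fin size_iota -natr1.
have : (K%:R + 1) * (64 * (c * c) * r) <= (2 * ln r^-1) * (64 * (c * c) * r).
  by rewrite ler_wpM2r ?mulr_ge0 ?(ltW r0)//; lra.
have : 0 <= r * ln r^-1 by rewrite mulr_ge0//; lra.
by lra.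
Qed.
End upper.

(** * The lower bound *)

Section lower_contain.
Variable R : realType.
Implicit Types (g h : mat R) (r : R) (m n : int).

Definition mulmat h g : mat R :=
  ((h.1.1 * g.1.1 + h.1.2 * g.2.1, h.1.1 * g.1.2 + h.1.2 * g.2.2),
   (h.2.1 * g.1.1 + h.2.2 * g.2.1, h.2.1 * g.1.2 + h.2.2 * g.2.2)).

Lemma act_latt h g : act h (latt g) = latt (mulmat h g).
Proof.
have mm m n : mulmv h (mulmv g (m%:~R, n%:~R)) = mulmv (mulmat h g) (m%:~R, n%:~R).
  by rewrite /mulmv/=; congr (_, _); ring.
apply/seteqP; split=> v /=.
  by move=> [_ [m [n ->]] <-]; exists m, n; exact: mm.
by move=> [m [n ->]]; exists (mulmv g (m%:~R, n%:~R)); [exists m, n | exact: mm].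
Qed.

(** The signs of [x] and [y] prevent cancellation: coefficients of equal sign add up in the first
    coordinate, those of opposite sign in the second. *)
Lemma sheared_supnorm_ge (x y q k : R) m n : 0 <= x -> y <= 0 -> 0 <= k -> k <= 1 -> k <= q ->
  (m, n) != (0, 0) -> k <= supnorm (m%:~R + n%:~R * x, m%:~R * y + n%:~R * q).
Proof.
move=> x0 y0 k0 k1 kq mn; rewrite /supnorm le_max/=.
have geR (j : int) : 1 <= j -> 1 <= j%:~R :> R by rewrite (_ : 1 = 1%:~R :> R)// ler_int.
have case5 : [\/ 1 <= m /\ 0 <= n, m <= -1 /\ n <= 0, m <= 0 /\ 1 <= n | 0 <= m /\ n <= -1].
  move: mn; rewrite xpair_eqE negb_and; clear.
  have [|] := leP 1 m; have [|] := leP 1 n; have [|] := leP 0 m; have [|] := leP 0 n => *.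
  all: try (by constructor 1; lia).
  all: try (by constructor 2; lia).
  all: try (by constructor 3; lia).
  all: try (by constructor 4; lia).
have nx (u v : R) : k <= u -> 0 <= v -> k <= `|u + v|.
  by move=> ku v0; apply: le_trans (ler_norm _); lra.
case: case5 => -[h1 h2].
- apply/orP; left; apply: nx; first by apply: (le_trans k1); exact: geR.
  by rewrite mulr_ge0// ler0z.
- apply/orP; left; rewrite -normrN opprD; apply: nx.
    by apply: (le_trans k1); rewrite -rmorphN/=; apply: geR; lia.
  by rewrite -mulNr -rmorphN/= mulr_ge0// ler0z; lia.
- apply/orP; right; rewrite addrC; apply: nx.
    apply: (le_trans kq); rewrite ler_peMl//; [lra|exact: geR].
  by rewrite mulr_le0// lerz0.
- apply/orP; right; rewrite -normrN opprD addrC; apply: nx.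
    rewrite -mulNr -rmorphN/=; apply: (le_trans kq); rewrite ler_peMl//; [lra|].
    by apply: geR; lia.
  by rewrite oppr_ge0 mulr_ge0_le0// ler0z.
Qed.

(** The first column has norm 1, so [Delta] is nonnegative. No vector is shorter than
    $e^{-r}\le1-r/2\le1+xy$. *)
Lemma sheared_K r (x y : R) : 0 < r -> r <= 1 -> 0 <= x -> y <= 0 -> `|y| <= 1 ->
  - (x * y) <= r / 2 -> K_ r (latt ((1, x), (y, 1 + x * y))).
Proof.
move=> r0 r1 x0 y0 y1 xy; set W : mat R := (_, _).
have dW : det W = 1 by rewrite /det/=; ring.
split; first by exists W.
have e1 : expR (- r) <= 1 - r / 2.
  rewrite expRN; have := expR_ge1Dx r; have := expR_gt0 r; set e := expR r => e0 er.
  rewrite -[e^-1]div1r ler_pdivrMr//.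
  have : (1 - r / 2) * (1 + r) <= (1 - r / 2) * e by rewrite ler_wpM2l//; lra.
  have : 0 <= r * (1 - r) by rewrite mulr_ge0//; lra.
  lra.
split.
  apply: ereal_sup_ubound; exists (1, y).
    split; last by move=> [] /eqP; rewrite oner_eq0.
    exists 1, 0; rewrite /mulmv/= mulr1z mulr0z; congr (_, _); ring.
  by rewrite /supnorm/= normr1 max_l// invr1 ln1.
apply: ge_ereal_sup => _ [v [[m [n vE]] v0] <-].
have mn : (m, n) != (0, 0).
  apply/eqP => -[m0 n0]; apply: v0; rewrite vE m0 n0 /mulmv/= mulr0z.
  by rewrite !mulr0 !addr0.
have : expR (- r) <= supnorm v.
  have -> : v = (m%:~R + n%:~R * x, m%:~R * y + n%:~R * (1 + x * y)).
    by rewrite vE /mulmv/=; congr (_, _); ring.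
  apply: sheared_supnorm_ge => //.
    by apply: (le_trans e1); lra.
  by apply: (le_trans e1); lra.
move=> sv; have sv0 : 0 < supnorm v by apply: lt_le_trans sv; exact: expR_gt0.
rewrite lee_fin lnV ?posrE// lerNl -[leLHS]expRK.
by rewrite ler_ln ?posrE ?expR_gt0.
Qed.

Lemma box_sub_FDcone r (a b c d : R) : 0 < r -> r <= 1 ->
  45 / 100 <= a -> a <= 1 / 2 -> 9 / 10 <= d -> d <= 1 ->
  0 <= b -> b <= 1 / 10 -> c <= 0 -> - c <= 1 / 10 -> b * (- c) <= r / 5 ->
  FDcone (Ucyl r) ((a, b), (c, d)).
Proof.
move=> r0 r1 a0 a1 d0 d1 b0 b1 c0 c1 bc.
set g : mat R := (_, _).
have [ap bp cp dp] : [/\ 0 <= a, 0 <= b, 0 <= - c & 0 <= d] by split; lra.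
have ad0 : 45 / 100 * (9 / 10) <= a * d by apply: ler_pM => //; rewrite divr_ge0.
have ad1 : a * d <= 1 / 2 * 1 by exact: ler_pM.
have aa0 : 45 / 100 * (45 / 100) <= a * a by apply: ler_pM => //; rewrite divr_ge0.
have aa1 : a * a <= 1 / 2 * (1 / 2) by exact: ler_pM.
have dd0 : 9 / 10 * (9 / 10) <= d * d by apply: ler_pM => //; rewrite divr_ge0.
have bc0 : 0 <= b * (- c) by exact: mulr_ge0.
have bc1 : b * (- c) <= 1 / 10 * (1 / 10) by exact: ler_pM.
have cc1 : (- c) * (- c) <= 1 / 10 * (1 / 10) by exact: ler_pM.
have ab0 : 0 <= a * b by exact: mulr_ge0.
have ab1 : a * b <= 1 / 2 * (1 / 10) by exact: ler_pM.
have cd0 : 0 <= (- c) * d by exact: mulr_ge0.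
have cd1 : (- c) * d <= 1 / 10 * 1 by exact: ler_pM.
have ac1 : (- c) * a <= 1 / 10 * (1 / 2) by exact: ler_pM.
pose D := det g; have DE : D = a * d + b * (- c) by rewrite /D /det/=; ring.
have D4 : 405 / 1000 <= D by rewrite DE; move: ad0 bc0; clear; lra.
have D5 : D <= 51 / 100 by rewrite DE; move: ad1 bc1; clear; lra.
have D0 : 0 < D by move: D4; clear; lra.
split; first exact: D0.
split; first by rewrite -/D; move: D5; clear; lra.
split.
  have := sqr_ge0 b; have := sqr_ge0 c; rewrite /reduced/= => cc0 bb0.
  rewrite !expr2 -[c * c]mulrNN; split.
    by move: dd0 aa1 cc1 bb0; rewrite expr2; clear; lra.
  have : `|a * b + c * d| <= 1 / 10.
    by rewrite ler_norml; move: ab0 ab1 cd0 cd1; clear; lra.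
  by move: aa0 cc0; rewrite expr2 -mulrNN; clear; lra.
rewrite -/D; set t := Num.sqrt D.
have t0 : 0 < t by rewrite sqrtr_gt0.
have tE : t * t = D by rewrite -expr2 sqr_sqrtr// ltW.
have {}ap : 0 < a by lra.
have at1 : a <= t.
  rewrite -(ler_pXn2r (_ : 0 < 2)%N) ?nnegrE ?ltW// !expr2 tE.
  by move: aa1 D4; clear; lra.
have ta2 : t < 2 * a.
  rewrite -(ltr_pXn2r (_ : 0 < 2)%N) ?nnegrE ?ltW ?mulr_gt0// !expr2 tE.
  by move: aa0 D5; clear; lra.
have ta0 : 0 < t / a by rewrite divr_gt0.
have [an tn Dn] : [/\ a != 0, t != 0 & D != 0] by rewrite !gt_eqF.
(* This time turns the upper left entry of the normalised basis into 1; [a <= t < 2 * a] and $2\le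
   e$ place it in $[0,1)$. *)
exists (ln (t / a)); split; first by rewrite ln_ge0// ler_pdivlMr// mul1r.
split.
  rewrite -[ltRHS]expRK ltr_ln ?posrE ?expR_gt0//.
  by apply: lt_le_trans (expR_ge1Dx _); rewrite ltr_pdivrMr.
exists (latt ((1, b / a), (c * a / D, 1 + b / a * (c * a / D)))).
  have xyE : b / a * (c * a / D) = b * c / D by field; rewrite an Dn.
  have yE : c * a / D = - ((- c) * a / D) by field.
  have y0 : 0 <= (- c) * a / D by rewrite divr_ge0 ?mulr_ge0 ?oppr_ge0// ltW.
  apply: sheared_K => //.
  - by rewrite divr_ge0// ltW.
  - by rewrite yE oppr_le0.
  - by rewrite yE normrN ger0_norm// ler_pdivrMr//; move: ac1 D4; clear; lra.
  - rewrite xyE -mulNr -mulrN ler_pdivrMr//.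
    (* The hypothesis allows $r/5$, which is below half of $0.405\,r\le rD$. *)
    have : r / 2 * (405 / 1000) <= r / 2 * D by rewrite ler_wpM2l// divr_ge0// ltW.
    by move: bc r0; clear; lra.
have qE : 1 + b / a * (c * a / D) = a * d / D.
  have -> : a * d = D + b * c by rewrite DE; ring.
  by field; rewrite an Dn.
rewrite act_latt qE -tE; congr latt.
rewrite /mulmat /a_ /scalemat /= opprK expRN lnK ?posrE// !invf_div.
clearbody t; congr (_, _); congr (_, _); field; rewrite ?an ?tn//.
Qed.
End lower_contain.

(** * Disjoint boxes inside the cylinder *)

Section lower.
Variable R : realType.
Local Notation leb := (@lebesgue_measure R).
Local Notation leb2 := (leb \x leb)%E.

Lemma leb_itv_oc (a b : R) : a <= b -> leb `]a, b] = (b - a)%:E.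
Proof.
move=> ab; rewrite lebesgue_measure_itv/= lte_fin; case: ltP => // ba.
by rewrite (le_anti (introT andP (conj ab ba))) subrr.
Qed.

Lemma leb2X (A B : set (measurableTypeR R)) : measurable A -> measurable B ->
  leb2 (A `*` B) = (leb A * leb B)%E.
Proof. exact: product_measure1E. Qed.

Local Notation RR := (measurableTypeR R * measurableTypeR R)%type.

(** The ranges of [b] and [-c] multiply to at most $r/5$ at every scale; half-open ranges of [b]
    make the boxes disjoint. *)
Definition scale_box (r : R) (k : nat) : set (mat R) :=
  (`[45 / 100, 1 / 2] `*` `]expR (- k.+1%:R) / 10, expR (- k%:R) / 10]) `*`
  (`[- (2 * r * expR k%:R), 0] `*` `[9 / 10, 1]).

Lemma scale_box_sub (r : R) k : 0 < r -> r <= 1 -> 2 * r * expR k%:R <= 1 / 10 ->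
  scale_box r k `<=` FDcone (Ucyl r).
Proof.
move=> r0 r1 rk [[a b] [c d]] [[/= A B] [/= C D]].
move: A B C D; rewrite /= !in_itv/= => /andP[a0 a1] /andP[b0 b1] /andP[c0 c1] /andP[d0 d1].
have e0 := expR_gt0 (- k.+1%:R : R); have b0' : 0 <= b.
  by apply: ltW; apply: le_lt_trans b0; rewrite divr_ge0// ltW.
have cr : - c <= 2 * r * expR k%:R by rewrite lerNl.
apply: box_sub_FDcone => //.
- by apply: (le_trans b1); rewrite ler_pM2r ?invr_gt0// -[leRHS]expR0 ler_expR oppr_le0.
- exact: le_trans cr rk.
have -> : r / 5 = expR (- k%:R) / 10 * (2 * r * expR k%:R).
  have : expR (- k%:R) * expR k%:R = 1 :> R by rewrite -expRD addNr expR0.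
  move=> ee; transitivity (r / 5 * (expR (- k%:R) * expR k%:R)); first by rewrite ee mulr1.
  by field.
by apply: ler_pM => //; rewrite oppr_ge0.
Qed.

Lemma measurable_scale_box r k :
  measurable (scale_box r k : set (RR * RR)).
Proof. by apply: measurableX; apply: measurableX; exact: measurable_itv. Qed.

Lemma leb4_scale_box_ge (r : R) k : 0 < r -> ((r / 2000)%:E <= leb4 (scale_box r k))%E.
Proof.
move=> r0; rewrite leb4E lebesgue4X; try by apply: measurableX; exact: measurable_itv.
rewrite !leb2X; try exact: measurable_itv.
have e0 := expR_gt0 (k%:R : R); have e0' := expR_gt0 (- k%:R : R).
(* Since $e\ge2$, the range of [b] has length at least $e^{-k}/20$. *)
have eS : expR (- k.+1%:R) <= expR (- k%:R) / 2 :> R.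
  rewrite -natr1 opprD expRD ler_pM2l// expRN lef_pV2 ?posrE ?expR_gt0//.
  exact: expR_ge1Dx.
have le0 : 0 <= 2 * r * expR k%:R by rewrite !mulr_ge0// ltW.
have I1 : leb `[45 / 100, 1 / 2] = (1 / 2 - 45 / 100)%:E by apply: leb_itv; clear; lra.
have I2 : leb `[9 / 10, 1] = (1 - 9 / 10)%:E by apply: leb_itv; clear; lra.
have I3 : leb `[- (2 * r * expR k%:R), 0] = (0 - - (2 * r * expR k%:R))%:E.
  by apply: leb_itv; rewrite oppr_le0.
have I4 := @leb_itv_oc (expR (- k.+1%:R) / 10) (expR (- k%:R) / 10).
rewrite I1 I2 I3 I4; last by move: eS e0'; clear; lra.
rewrite -!EFinM lee_fin.
have ee : expR (- k%:R) * expR k%:R = 1 :> R by rewrite -expRD addNr expR0.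
have : (expR (- k%:R) / 20) * (2 * r * expR k%:R) <=
    (expR (- k%:R) / 10 - expR (- k.+1%:R) / 10) * (2 * r * expR k%:R).
  by rewrite ler_wpM2r//; move: eS; clear; lra.
have -> : (expR (- k%:R) / 20) * (2 * r * expR k%:R) = r / 10.
  transitivity (r / 10 * (expR (- k%:R) * expR k%:R)); last by rewrite ee mulr1.
  by field.
set z := _ * (2 * r * _) => rz.
have -> : (1 / 2 - 45 / 100) * (expR (- k%:R) / 10 - expR (- k.+1%:R) / 10) *
  ((0 - - (2 * r * expR k%:R)) * (1 - 9 / 10)) = z / 200 by rewrite /z; field.
by move: rz; clear; lra.
Qed.

Lemma trivIset_scale_box r (D : set nat) : trivIset D (scale_box r).
Proof.
apply/trivIsetP => i j _ _.
wlog ij : i j / (i < j)%N => [wl|_].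
  by case: ltngtP => // ij _; [|rewrite setIC]; apply: wl => //; rewrite ltn_eqF.
rewrite -subset0 => -[[a b] cd] [[[/= _ +] _] [[/= _ +] _]].
rewrite /= !in_itv/= => /andP[b1 _] /andP[_ b2].
have : expR (- j%:R) / 10 <= expR (- i.+1%:R) / 10 :> R.
  by rewrite ler_pM2r ?invr_gt0// ler_expR lerN2 ler_nat.
by rewrite leNgt (lt_le_trans b1 b2).
Qed.

(** The boxes with $20re^k\le1$ fit, and there are at least $\ln(1/(20r))$ of them. For $r\le1/400$
    one has $(20r)^2\le r$, so this is at least half of $\ln(1/r)$. *)
Lemma leb4_FDcone_Ucyl_ge (r : R) : 0 < r -> r <= 1 / 400 ->
  ((1 / 4000 * (r * ln r^-1))%:E <= leb4 (FDcone (Ucyl r)))%E.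
Proof.
move=> r0 r1.
have r20 : 0 < (20 * r)^-1 by rewrite invr_gt0 mulr_gt0.
pose K := (Num.truncn (ln (20 * r)^-1)).+1.
have r40 : 20 * r <= 1 by lra.
have L0 : 0 <= ln (20 * r)^-1 by rewrite ln_ge0// invf_ge1 ?mulr_gt0.
have LK : ln (20 * r)^-1 <= K%:R by rewrite ltW// truncnS_gt.
have sub k : (k < K)%N -> scale_box r k `<=` FDcone (Ucyl r).
  move=> kK; apply: scale_box_sub => //; first lra.
  have kL : k%:R <= ln (20 * r)^-1.
    by apply: (@le_trans _ _ (Num.truncn (ln (20 * r)^-1))%:R); rewrite ?ler_nat ?truncn_le.
  have : expR k%:R <= (20 * r)^-1 by rewrite -[leRHS]lnK ?posrE// ler_expR.
  rewrite -[_^-1]div1r ler_pdivlMr ?mulr_gt0//; clear; lra.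
apply: (@le_trans _ _ (leb4 (\big[setU/set0]_(k < K) scale_box r k))); last first.
  apply: le_leb4; rewrite -bigcup_mkord; apply: bigcup_sub => k; exact: sub.
rewrite leb4E measure_semi_additive_ord_I; first last.
- by apply: bigsetU_measurable => k _; exact: measurable_scale_box.
- exact: trivIset_scale_box.
- by move=> k _; exact: measurable_scale_box.
apply: (@le_trans _ _ (\sum_(k < K) (r / 2000)%:E)%E); last first.
  by apply: lee_sum => k _; exact: (leb4_scale_box_ge k r0).
rewrite sumEFin lee_fin sumr_const card_ord -mulr_natl.
have L2 : ln r^-1 <= 2 * ln (20 * r)^-1.
  rewrite mulr_natl -lnXn// ler_ln ?posrE ?invr_gt0// ?exprn_gt0//.
  rewrite exprVn lef_pV2 ?posrE ?exprn_gt0 ?mulr_gt0//.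
  have : r * r <= r * (1 / 400) by rewrite ler_pM2l.
  by rewrite expr2; clear; lra.
have : r * ln r^-1 <= r * (2 * K%:R) by rewrite ler_pM2l//; move: L2 LK; clear; lra.
by clear; lra.
Qed.
End lower.

(** * Finiteness of the covolume *)

Section covolume.
Variable R : realType.
Local Notation leb := (@lebesgue_measure R).
Local Notation leb2 := (leb \x leb)%E.
Local Notation RR := (measurableTypeR R * measurableTypeR R)%type.

(* Pieces of the reduction domain on which the first column has length about
   [e]. For a fixed first row, the entry [d] of the second row is confined by
   the determinant when [c] is tiny, and by the inner product otherwise. *)
Definition cusp_det (e : R) : set (RR * RR) := [set g |
  (`|g.1.1| <= e /\ `|g.1.2| <= 4 / e) /\ e / 2 <= `|g.1.1| /\
  `|g.2.1| <= e ^+ 2 / 4 /\ `|g.1.1 * g.2.2 - g.1.2 * g.2.1| <= 1].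

Definition cusp_ip (e : R) : set (RR * RR) := [set g |
  (`|g.1.1| <= e /\ `|g.1.2| <= 4 / e) /\ `|g.2.1| <= e /\
  e ^+ 2 / 4 <= `|g.2.1| /\ `|g.1.1 * g.1.2 + g.2.1 * g.2.2| <= e ^+ 2].

Lemma measurable_entry11 : measurable_fun setT (fun g : RR * RR => g.1.1).
Proof. exact: (measurableT_comp measurable_fst measurable_fst). Qed.
Lemma measurable_entry12 : measurable_fun setT (fun g : RR * RR => g.1.2).
Proof. exact: (measurableT_comp measurable_snd measurable_fst). Qed.
Lemma measurable_entry21 : measurable_fun setT (fun g : RR * RR => g.2.1).
Proof. exact: (measurableT_comp measurable_fst measurable_snd). Qed.
Lemma measurable_entry22 : measurable_fun setT (fun g : RR * RR => g.2.2).
Proof. exact: (measurableT_comp measurable_snd measurable_snd). Qed.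

Lemma measurable_norm_le (f : RR * RR -> R) (k : R) :
  measurable_fun setT f -> measurable [set g : RR * RR | `|f g| <= k].
Proof.
move=> mf; apply: (@measurable_set_le _ (RR * RR)%type); last exact: measurable_cst.
exact: measurableT_comp.
Qed.

Lemma measurable_norm_ge (f : RR * RR -> R) (k : R) :
  measurable_fun setT f -> measurable [set g : RR * RR | k <= `|f g|].
Proof.
move=> mf; apply: (@measurable_set_le _ (RR * RR)%type); first exact: measurable_cst.
exact: measurableT_comp.
Qed.

Lemma measurable_cusp_det e : measurable (cusp_det e).
Proof.
have m11 := measurable_entry11; have m12 := measurable_entry12.
have m21 := measurable_entry21; have m22 := measurable_entry22.
apply: measurableI; first by apply: measurableI; exact: measurable_norm_le.
apply: measurableI; first exact: measurable_norm_ge.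
apply: measurableI; first exact: measurable_norm_le.
by apply: measurable_norm_le; apply: measurable_funB; exact: measurable_funM.
Qed.

Lemma measurable_cusp_ip e : measurable (cusp_ip e).
Proof.
have m11 := measurable_entry11; have m12 := measurable_entry12.
have m21 := measurable_entry21; have m22 := measurable_entry22.
apply: measurableI; first by apply: measurableI; exact: measurable_norm_le.
apply: measurableI; first exact: measurable_norm_le.
apply: measurableI; first exact: measurable_norm_ge.
by apply: measurable_norm_le; apply: measurable_funD; exact: measurable_funM.
Qed.

Definition row_box (e : R) : set RR := `[- e, e] `*` `[- (4 / e), 4 / e].

Lemma measurable_row_box e : measurable (row_box e).
Proof. by apply: measurableX; exact: measurable_itv. Qed.

Lemma leb2_row_box e : 0 < e -> leb2 (row_box e) = 16%:E.
Proof.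
move=> e0; rewrite leb2X; try exact: measurable_itv.
have e4 : 0 < 4 / e by rewrite divr_gt0.
rewrite !leb_itv -?EFinM; [|lra|lra].
by congr EFin; field; rewrite gt_eqF.
Qed.

(** For a fixed first row, [c] has range $e^2/2$ and [d] has range at most $2/|a|\le4/e$, in total
    $2e$; the first row has area 16. *)
Lemma leb4_cusp_det_le e : 0 < e -> (leb4 (cusp_det e) <= (32 * e)%:E)%E.
Proof.
move=> e0; have -> : (32 * e)%:E = ((2 * e)%:E * leb2 (row_box e))%E.
  by rewrite leb2_row_box// -EFinM; congr EFin; ring.
have ee0 : 0 <= e ^+ 2 / 4 by rewrite divr_ge0// sqr_ge0.
apply: (@product_measure_le_sections _ _ _ _ _ (@lebesgue2 R) (@lebesgue2 R)
  (cusp_det e) (row_box e) (2 * e)).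
- by rewrite mulr_ge0// ltW.
- exact: measurable_row_box.
- by move=> [[a b] y] [[/= a1 b1] _]; split; rewrite /= in_itv/= -ler_norml.
move=> [a b] _.
apply: (@le_trans _ _ ((4 / e)%:E * leb `[(- (e ^+ 2 / 4))%R, (e ^+ 2 / 4)%R])%E); last first.
  rewrite leb_itv; last by lra.
  rewrite -EFinM lee_fin le_eqVlt; apply/orP; left; apply/eqP.
  by field; rewrite gt_eqF.
apply: product_measure_le_sections => //.
- by rewrite divr_ge0// ltW.
- by move=> [c d] [_ [_ [/= c1 _]]]; rewrite in_itv/= -ler_norml.
move=> c _.
have [ae|ae] := leP (e / 2) `|a|; last first.
  apply: (@le_trans _ _ (leb set0)); last by rewrite measure0 lee_fin divr_ge0// ltW.
  by apply: le_lebesgue => d [_ [/= ea _]]; move: ae; rewrite ltNge ea.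
have a0 : 0 < `|a| by apply: lt_le_trans ae; rewrite divr_gt0.
apply: (@le_trans _ _ (leb [set d | `|a * d + - (b * c)| <= 1])).
  by apply: le_lebesgue => d [_ [_ [_ /=]]].
apply: le_trans; first by apply: lebesgue_abs_affine_le; rewrite -?normr_gt0.
rewrite lee_fin mulr1 ler_pdivrMr// mulrAC ler_pdivlMr//; lra.
Qed.

(** For a fixed first row, [c] has range at most $2e$ and [d] at most $2e^2/|c|\le8$. *)
Lemma leb4_cusp_ip_le e : 0 < e -> (leb4 (cusp_ip e) <= (256 * e)%:E)%E.
Proof.
move=> e0; have -> : (256 * e)%:E = ((16 * e)%:E * leb2 (row_box e))%E.
  by rewrite leb2_row_box// -EFinM; congr EFin; ring.
have ee0 : 0 < e ^+ 2 by rewrite exprn_gt0.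
apply: (@product_measure_le_sections _ _ _ _ _ (@lebesgue2 R) (@lebesgue2 R)
  (cusp_ip e) (row_box e) (16 * e)).
- by rewrite mulr_ge0// ltW.
- exact: measurable_row_box.
- by move=> [[a b] y] [[/= a1 b1] _]; split; rewrite /= in_itv/= -ler_norml.
move=> [a b] _.
apply: (@le_trans _ _ (8%:E * leb `[(- e)%R, e])%E); last first.
  by rewrite leb_itv -?EFinM ?lee_fin; lra.
apply: product_measure_le_sections => //.
- by move=> [c d] [_ [/= c1 _]]; rewrite in_itv/= -ler_norml.
move=> c _.
have [ae|ae] := leP (e ^+ 2 / 4) `|c|; last first.
  apply: (@le_trans _ _ (leb set0)); last by rewrite measure0 lee_fin.
  by apply: le_lebesgue => d [_ [_ [/= ea _]]]; move: ae; rewrite ltNge ea.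
have a0 : 0 < `|c| by apply: lt_le_trans ae; rewrite divr_gt0.
apply: (@le_trans _ _ (leb [set d | `|c * d + a * b| <= e ^+ 2])).
  by apply: le_lebesgue => d [_ [_ [_ /=]]]; rewrite addrC.
apply: le_trans; first by apply: lebesgue_abs_affine_le; rewrite -?normr_gt0// ltW.
rewrite lee_fin ler_pdivrMr//; lra.
Qed.

(** Equal to $2^{1-k}$, in the form summed by [epsilon_trick0]. *)
Definition cusp_scale (k : nat) : R := 4 / (2 ^ k.+1)%:R.

Lemma cusp_scaleS k : cusp_scale k.+1 = cusp_scale k / 2.
Proof.
rewrite /cusp_scale !natrX [2 ^+ k.+2]exprS; field.
by rewrite expf_neq0.
Qed.

Lemma cusp_scale_gt0 k : 0 < cusp_scale k.
Proof. by rewrite divr_gt0// ltr0n expn_gt0. Qed.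

Lemma cusp_scale_le2 k : cusp_scale k <= 2.
Proof.
elim: k => [|k IH]; first by rewrite /cusp_scale expn1; lra.
by rewrite cusp_scaleS; have := cusp_scale_gt0 k; lra.
Qed.

Lemma cusp_scale_select (x : R) : 0 < x -> x <= 2 ->
  exists k, x <= cusp_scale k /\ cusp_scale k / 2 < x.
Proof.
move=> x0 x2.
have ex : exists k, cusp_scale k / 2 < x.
  exists (Num.bound (4 / x)).
  have x4 : 0 <= 4 / x by rewrite divr_ge0// ltW.
  rewrite -cusp_scaleS /cusp_scale ltr_pdivrMr ?ltr0n ?expn_gt0// mulrC -ltr_pdivrMr//.
  apply: (lt_le_trans (archi_boundP x4)); rewrite ler_nat.
  apply: (leq_trans (ltnW (ltn_expl _ (isT : 1 < 2)%N))).
  by rewrite leq_exp2l// ltnW// ltnW.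
case: (ex_minnP ex) => k Pk kmin; exists k; split => //.
case: k Pk kmin => [|k] Pk kmin; first by rewrite /cusp_scale expn1; lra.
by rewrite cusp_scaleS leNgt; apply/negP => /kmin; rewrite ltnn.
Qed.

(** Choose $e/2<\max(|a|,|c|)\le e$; then $n_1n_2\le4$ gives $|b|\le4/e$. If $|c|\ge e^2/4$,
    reduction bounds the inner product by $e^2$. Otherwise $|c|<e/2$, so the maximum is $|a|$ and
    the determinant bound applies. *)
Lemma reduced_cover (g : mat R) : 0 < det g -> det g <= 1 -> reduced g ->
  exists k, (cusp_det (cusp_scale k) `|` cusp_ip (cusp_scale k)) g.
Proof.
move=> D0 D1 rg; have := reduced_n1n2 rg; have [n12 ip] := rg.
move: g D0 D1 rg n12 ip => [[a b] [c d]]; rewrite /det/= => D0 D1 rg n12 ip N12.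
have {}N12 : (a ^+ 2 + c ^+ 2) * (b ^+ 2 + d ^+ 2) <= 4.
  have : (a * d - b * c) ^+ 2 <= 1 by rewrite expr_le1// ltW.
  by move: N12; clear; lra.
pose x := Num.max `|a| `|c|.
have ax : `|a| <= x by rewrite le_max lexx.
have cx : `|c| <= x by rewrite le_max lexx orbT.
have x0 : 0 < x.
  rewrite lt_max !normr_gt0 -negb_and; apply/negP => /andP[/eqP a0 /eqP c0].
  by move: D0; rewrite a0 c0 mul0r mulr0 subrr ltxx.
have x1 : x ^+ 2 <= a ^+ 2 + c ^+ 2.
  have [ac|/ltW ac] := leP `|a| `|c|.
    by rewrite /x (max_r ac) real_normK ?num_real// lerDr sqr_ge0.
  by rewrite /x (max_l ac) real_normK ?num_real// lerDl sqr_ge0.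
have sq (u : R) : `|u| <= x -> u ^+ 2 <= x ^+ 2.
  by move=> ux; rewrite -[u ^+ 2]real_normK ?num_real// ler_pXn2r ?nnegrE// ltW.
have x2 : x <= 2.
  have h : (x ^+ 2) ^+ 2 <= (2 ^+ 2) * 1.
    rewrite mulr1; apply: le_trans (_ : (a ^+ 2 + c ^+ 2) * (b ^+ 2 + d ^+ 2) <= _).
      rewrite expr2; apply: ler_pM; rewrite ?sqr_ge0//; exact: le_trans x1 n12.
    by rewrite (le_trans N12)// expr2; clear; lra.
  rewrite -(ler_pXn2r (_ : 0 < 2)%N) ?nnegrE ?(ltW x0)//.
  rewrite -(ler_pXn2r (_ : 0 < 2)%N) ?nnegrE// ?sqr_ge0//.
  by apply: le_trans h _; rewrite !expr2; clear; lra.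
have [k [xk kx]] := cusp_scale_select x0 x2; exists k.
move: xk kx (cusp_scale_gt0 k) (cusp_scale_le2 k); set e := cusp_scale k => xe ex e0 e2.
have aE : `|a| <= e by exact: le_trans ax xe.
have cE : `|c| <= e by exact: le_trans cx xe.
have bE : `|b| <= 4 / e.
  apply: ler_normsq; first by rewrite divr_ge0// ltW.
  rewrite expr_div_n ler_pdivlMr ?exprn_gt0//.
  have ex2 : e ^+ 2 / 4 <= a ^+ 2 + c ^+ 2.
    apply: le_trans x1; have -> : e ^+ 2 / 4 = (e / 2) ^+ 2 by field.
    by rewrite ler_pXn2r ?nnegrE ?divr_ge0 ?ltW.
  have : b ^+ 2 * (e ^+ 2 / 4) <= 4.
    apply: le_trans N12; rewrite mulrC; apply: ler_pM; rewrite ?sqr_ge0//.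
      by rewrite divr_ge0// sqr_ge0.
    by rewrite lerDl sqr_ge0.
  by rewrite [4 ^+ 2]expr2; clear; lra.
have e4 : e ^+ 2 / 4 <= e / 2.
  have : e * e <= e * 2 by rewrite ler_pM2l.
  by rewrite expr2; clear; lra.
have [ce|ce] := leP (e ^+ 2 / 4) `|c|.
  right; split => //; split => //; split => //=.
  have xe2 : x ^+ 2 <= e ^+ 2 by rewrite ler_pXn2r ?nnegrE// ltW.
  have := sq _ ax; have := sq _ cx; move: ip xe2; clear; lra.
left; split => //; split => /=.
  have ca : `|c| < `|a|.
    rewrite ltNge; apply/negP => ac; move: ex; rewrite /x (max_r ac) => ex.
    by move: ce e4 ex; clear; lra.
  by move: ex; rewrite /x (max_l (ltW ca)) => /ltW.
split; first exact: ltW.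
by rewrite ger0_norm// ltW.
Qed.

(** The pieces at scale $e$ have total measure at most $(32+256)e$, which is summable over the
    dyadic scales. *)
Lemma leb4_FDcone_lty (E : set (set (R * R))) : (leb4 (FDcone E) < +oo)%E.
Proof.
pose F k := cusp_det (cusp_scale k) `|` cusp_ip (cusp_scale k).
have mF k : measurable (F k).
  by apply: measurableU; [exact: measurable_cusp_det|exact: measurable_cusp_ip].
apply: (@le_lt_trans _ _ (leb4 (\bigcup_k F k))).
  by apply: le_leb4 => g [D0 [D1 [rg _]]]; have [k Fk] := reduced_cover D0 D1 rg; exists k.
rewrite leb4E.
apply: (@le_lt_trans _ _ (\sum_(k <oo) lebesgue4 R (F k))%E).
  by apply: measure_sigma_subadditive => //; exact: bigcupT_measurable.
apply: (@le_lt_trans _ _ (\sum_(k <oo) ((288 * 4 : R) / (2 ^ k.+1)%:R)%:E)%E).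
  apply: lee_nneseries => k _ //.
  apply: le_trans; first by apply: measureU2;
    [exact: measurable_cusp_det|exact: measurable_cusp_ip].
  apply: le_trans; first by apply: leeD;
    [exact: leb4_cusp_det_le (cusp_scale_gt0 k)|exact: leb4_cusp_ip_le (cusp_scale_gt0 k)].
  rewrite -EFinD lee_fin /cusp_scale; set z := _%:R; clear; lra.
apply: le_lt_trans; first exact: epsilon_trick0.
exact: ltry.
Qed.
End covolume.

(** * Monotonicity of the cylinders and positivity of the covolume *)

Section monotonicity.
Variable R : realType.

Lemma sub_K (r r' : R) : r <= r' -> K_ r `<=` K_ r'.
Proof.
by move=> rr' L [uL [L0 Lr]]; split=> //; split=> //; apply: (le_trans Lr); rewrite lee_fin.
Qed.

Lemma sub_Ucyl (r r' : R) : r <= r' -> Ucyl r `<=` Ucyl r'.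
Proof.
move=> rr' L [s [s0 [s1 [L' KL' LE]]]]; exists s; split=> //; split=> //.
by exists L' => //; exact: sub_K KL'.
Qed.

Lemma sub_FDcone (E E' : set (set (R * R))) : E `<=` E' -> FDcone E `<=` FDcone E'.
Proof. by move=> EE' g [D0 [D1 [rg Eg]]]; split=> //; split=> //; split=> //; exact: EE'. Qed.

Lemma FDcone_sub_unimod (E : set (set (R * R))) : FDcone E `<=` FDcone (@unimod R).
Proof.
move=> g [D0 [D1 [rg _]]]; split=> //; split=> //; split=> //.
set t := Num.sqrt _; exists (scalemat t^-1 g); split => //.
have t0 : t != 0 by rewrite gt_eqF// sqrtr_gt0.
have -> : det (scalemat t^-1 g) = det g / t ^+ 2 by rewrite /det/=; field.
by rewrite sqr_sqrtr ?divff ?gt_eqF// ltW.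
Qed.

(** Positivity comes from the cylinder at $r=1/400$; finiteness matters as well, because [fine]
    sends infinity to 0. *)
Lemma covolume_gt0 : 0 < fine (leb4 (FDcone (@unimod R))).
Proof.
have r0 : 0 < 1 / 400 :> R by lra.
have L0 : 2 <= ln (1 / 400)^-1 :> R by apply: ln_inv_ge2; lra.
apply: fine_gt0; rewrite leb4_FDcone_lty andbT.
have := leb4_FDcone_Ucyl_ge r0 (lexx _).
move=> /le_trans /(_ (le_leb4 (@FDcone_sub_unimod (Ucyl (1 / 400))))).
apply: lt_le_trans; rewrite lte_fin.
by move: L0; set z := ln _; clear; lra.
Qed.
End monotonicity.

Theorem theorem1p3 (R : realType) :
  exists c1 c2 : R, 0 < c1 /\ 0 < c2 /\
    forall r : R, 0 < r -> r < ln (101 / 100) ->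
      ((c1 * (r * ln r^-1))%:E <= mu (Ucyl r))%E /\
      (mu (Ucyl r) <= (c2 * (r * ln r^-1))%:E)%E.
Proof.
have [C C0 upper] := leb4_FDcone_Ucyl_le R.
have V0 := covolume_gt0 R; rewrite /mu; set V := fine _ in V0 *.
have Vi : 0 < V^-1 by rewrite invr_gt0.
have c0 : 0 < 1 / 16000 :> R by lra.
exists (1 / 16000 * V^-1), (C * V^-1); split; first exact: mulr_gt0.
split; first exact: mulr_gt0.
move=> r r0 rlt.
have r1 : r <= 1 / 100.
  apply: (le_trans (ltW rlt)); have -> : 101 / 100 = 1 + 1 / 100 :> R by lra.
  by apply: le_ln1Dx; lra.
split.
  rewrite mulrAC EFinM lee_pmul2r ?lte_fin//.
  have r4 : 0 < r / 4 by rewrite divr_gt0.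
  (* The lower bound requires radius at most 1/400, so it is applied at [r / 4]; this turns 1/4000
     into 1/16000. *)
  apply: (@le_trans _ _ (leb4 (FDcone (Ucyl (r / 4))))); last first.
    by apply/le_leb4/sub_FDcone/sub_Ucyl; move: r0; clear; lra.
  apply: le_trans (leb4_FDcone_Ucyl_ge r4 _); last by move: r1; clear; lra.
  rewrite lee_fin.
  have : r * ln r^-1 <= r * ln (r / 4)^-1.
    rewrite ler_pM2l// ler_ln ?posrE ?invr_gt0//.
    by rewrite lef_pV2 ?posrE//; move: r0; clear; lra.
  by clear; lra.
rewrite mulrAC EFinM lee_pmul2r ?lte_fin//.
exact: upper.
Qed.
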